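(* Let $\alpha$ be a cardinal number. If $X$ is a separable or reflexive Banach space, then every infinite codimensional closed subspace of $X$ is totally $\alpha$-quasicomplemented in $X$ if, and only if, $\alpha<\aleph_0$.
   Context: Subspace means linear subspace; dimension means the cardinality of a Hamel basis; the codimension of a subspace $Y$ of a vector space $X$ is the dimension of the quotient space $X/Y$; $\aleph_0$ is the cardinality of the set of positive integers. A closed subspace $Y$ of a topological vector space $X$ is quasicomplemented in $X$ if there is a closed subspace $Z$ of $X$ such that $Y\cap Z=\{0\}$ and $Y+Z$ is dense in $X$; such a $Z$ is called a quasicomplement of $Y$ in $X$. For a cardinal number $\alpha$, a closed subspace $Y$ of a topological vector space $X$ is totally $\alpha$-quasicomplemented in $X$ if $Y$ is quasicomplemented in $X$ and, for each $\alpha$-dimensional subspace $F$ of $X$ with $F\cap Y=\{0\}$, there exists a quasicomplement $Z$ of $Y$ in $X$ containing $F$ such that $\dim Z/F=\infty$ (that is, $Z/F$ is infinite dimensional).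
   Formalization: For infinite α it is additionally assumed that X has an α-dimensional subspace; otherwise (e.g. X finite dimensional, α = ℵ₀, or α > dim X) the condition on F is vacuous and the ''only if'' part fails. *)

(* Defs.v *)
From HB Require Import structures.
From mathcomp Require Import all_boot all_order all_algebra.
From mathcomp Require Import generic_quotient ring_quotient complex.
From mathcomp Require Import all_classical all_reals all_analysis.

Set Implicit Arguments.
Unset Strict Implicit.
Unset Printing Implicit Defensive.

Import Order.TTheory GRing.Theory Num.Theory.
Import numFieldNormedType.Exports.

Local Open Scope classical_set_scope.
Local Open Scope card_scope.
Local Open Scope quotient_scope.
Local Open Scope ring_scope.

Variant scalars := RealScalars | ComplexScalars.

Definition scalar_field (R : realType) (s : scalars) : numFieldType :=
  match s with
  | RealScalars => R
  | ComplexScalars => R[i]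
  end.

(* Linear subspaces of V are the elements Y : submodClosed V. The quotient V / Y
   is the additive quotient of ring_quotient, to which scalar multiplication is
   added here; submodClosed does not inherit from zmodClosed, hence the
   predicate in_subspace. *)
Section QuotientSpace.
Variables (K : fieldType) (V : lmodType K) (Y : submodClosed V).

Definition in_subspace : {pred V} := fun x => x \in Y.

Let in_subspace_zmod_closed : zmod_closed in_subspace.
Proof. exact: GRing.submod_closedB (submodClosedP Y). Qed.

HB.instance Definition _ :=
  GRing.isZmodClosed.Build V in_subspace in_subspace_zmod_closed.

Definition quotient_space : Type := Quotient.quot in_subspace.

HB.instance Definition _ := GRing.Zmodule.on quotient_space.

Definition quotient_proj (x : V) : quotient_space :=
  \pi_(Quotient.quot in_subspace) x.

Definition quotient_scale (a : K) (u : quotient_space) : quotient_space :=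
  quotient_proj (a *: repr (u : Quotient.quot in_subspace)).

Lemma quotient_projP (u : quotient_space) : exists x, u = quotient_proj x.
Proof.
by exists (repr (u : Quotient.quot in_subspace)); rewrite /quotient_proj reprK.
Qed.

Lemma quotient_proj_eq (x y : V) :
  (quotient_proj x == quotient_proj y) = (x - y \in Y).
Proof. exact/esym/(Quotient.idealrBE in_subspace). Qed.

Lemma quotient_projD (x y : V) :
  quotient_proj (x + y) = quotient_proj x + quotient_proj y.
Proof. exact: (raddfD \pi_(Quotient.quot in_subspace)). Qed.

Lemma quotient_projZ (a : K) (x : V) :
  quotient_proj (a *: x) = quotient_scale a (quotient_proj x).
Proof.
apply/eqP; rewrite quotient_proj_eq -scalerBr rpredZ //.
by rewrite -quotient_proj_eq /quotient_proj reprK.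
Qed.

Let scaleA (a b : K) (u : quotient_space) :
  quotient_scale a (quotient_scale b u) = quotient_scale (a * b) u.
Proof.
by have [x ->] := quotient_projP u; rewrite -!quotient_projZ scalerA.
Qed.

Let scale1 : left_id 1 quotient_scale.
Proof.
by move=> u; have [x ->] := quotient_projP u; rewrite -quotient_projZ scale1r.
Qed.

Let scaleDr : right_distributive quotient_scale +%R.
Proof.
move=> a u v; have [x ->] := quotient_projP u; have [y ->] := quotient_projP v.
by rewrite -quotient_projD -!quotient_projZ scalerDr quotient_projD.
Qed.

Let scaleDl (u : quotient_space) : {morph quotient_scale^~ u : a b / a + b}.
Proof.
move=> a b; have [x ->] := quotient_projP u.
by rewrite -!quotient_projZ scalerDl quotient_projD.
Qed.

HB.instance Definition _ :=
  GRing.Zmodule_isLmodule.Build K quotient_space scaleA scale1 scaleDr scaleDl.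

Let proj_zmod_morphism : zmod_morphism quotient_proj.
Proof. by move=> x y; exact: (raddfB \pi_(Quotient.quot in_subspace)). Qed.

HB.instance Definition _ :=
  GRing.isZmodMorphism.Build V quotient_space quotient_proj proj_zmod_morphism.

HB.instance Definition _ :=
  GRing.isScalable.Build K V quotient_space *:%R quotient_proj quotient_projZ.

End QuotientSpace.

Section Dimension.
Variables (K : fieldType) (V : lmodType K).

Definition linearly_independent (B : set V) : Prop :=
  forall (s : seq V) (a : V -> K), uniq s -> [set` s] `<=` B ->
    \sum_(v <- s) a v *: v = 0 -> forall v, v \in s -> a v = 0.

Definition linear_span (B : set V) : set V :=
  [set x | exists (s : seq V) (a : V -> K),
    [set` s] `<=` B /\ x = \sum_(v <- s) a v *: v].

Definition hamel_basis (S B : set V) : Prop :=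
  linearly_independent B /\ linear_span B = S.

(* Cardinal numbers are represented by types: the cardinal of a type A is that
   of the set [set: A]. *)
Definition has_dimension (S : set V) (A : Type) : Prop :=
  exists2 B : set V, hamel_basis S B & B #= [set: A].

Definition infinite_dimensional (S : set V) : Prop :=
  exists2 B : set V, hamel_basis S B & infinite_set B.

End Dimension.

Definition infinite_codimensional (K : fieldType) (V : lmodType K)
    (Y : submodClosed V) : Prop :=
  infinite_dimensional [set: quotient_space Y].

(* For subspaces F of Z, the space Z / F is the image of Z in V / F. *)
Definition infinite_quotient (K : fieldType) (V : lmodType K)
    (Z F : submodClosed V) : Prop :=
  infinite_dimensional (quotient_proj F @` [set` Z]).

Section Quasicomplements.
Variables (K : numFieldType) (X : topologicalLmodType K).

Definition quasicomplement (Y Z : submodClosed X) : Prop :=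
  [/\ closed [set` Z],
      [set` Y] `&` [set` Z] = [set 0] &
      dense [set y + z | y in [set` Y] & z in [set` Z]]].

Definition quasicomplemented (Y : submodClosed X) : Prop :=
  exists Z : submodClosed X, quasicomplement Y Z.

Definition totally_quasicomplemented (A : Type) (Y : submodClosed X) : Prop :=
  quasicomplemented Y /\
  forall F : submodClosed X,
    has_dimension [set` F] A -> [set` F] `&` [set` Y] = [set 0] ->
    exists Z : submodClosed X,
      [/\ quasicomplement Y Z, [set` F] `<=` [set` Z] & infinite_quotient Z F].

End Quasicomplements.

Definition separable (T : topologicalType) : Prop :=
  exists2 D : set T, countable D & dense D.

Section Dual.
Variables (K : numFieldType) (X : normedModType K).

Definition dual_pred : {pred X -> K^o} :=
  fun f => `[< linear f /\ continuous f >].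

Let dual_submod_closed : submod_closed dual_pred.
Proof.
split.
  apply/asboolP; split; first by move=> a x y; rewrite /= scaler0 addr0.
  exact: cst_continuous.
move=> a f g /asboolP[lf cf] /asboolP[lg cg]; apply/asboolP; split.
  move=> b x y; rewrite /= !addrfctE !scalrfctE lf lg !scalerDr.
  rewrite !scalerA [a * b]mulrC.
  by rewrite addrACA.
move=> x; apply: (@cvgD K K^o X); last exact: cg.
apply: (@cvgZl_tmp K K^o X); exact: cf.
Qed.

HB.instance Definition _ :=
  GRing.isSubmodClosed.Build K (X -> K^o) dual_pred dual_submod_closed.

Record dual := Dual { dual_fun :> X -> K^o ; _ : dual_fun \in dual_pred }.

HB.instance Definition _ := [isSub for dual_fun].
HB.instance Definition _ := [Choice of dual by <:].
HB.instance Definition _ := [SubChoice_isSubLmodule of dual by <:].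

(* Two spelled-out norm conditions: `dual_norm_le f c` says that the operator
   norm of f is at most c, and a functional Phi on the dual belongs to the
   bidual when |Phi f| <= M * ||f|| for some constant M. *)
Definition dual_norm_le (f : dual) (c : K) : Prop :=
  0 <= c /\ forall x, `|f x| <= c * `|x|.

Definition in_bidual (Phi : {linear dual -> K^o}) : Prop :=
  exists2 M : K, 0 <= M & forall f c, dual_norm_le f c -> `|Phi f| <= M * c.

Definition reflexive_space : Prop :=
  forall Phi : {linear dual -> K^o}, in_bidual Phi ->
    exists x : X, forall f : dual, Phi f = f x.

End Dual.

(* Main.v *)
Require Import Defs.
From HB Require Import structures.
From mathcomp Require Import all_boot all_order all_algebra.
From mathcomp Require Import complex wochoice.
From mathcomp Require Import all_classical all_reals all_analysis.
From mathcomp Require Import ring lra.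

(* Finite alpha. It is enough that every closed subspace Y of X has a
   quasicomplement: if Z1 is one of the closed subspace Y + F, then Z1 + F is one
   of Y. In the separable case (Murray, Mackey) one builds a biorthogonal system
   (u_i, psi_i) such that each u_i lies in Y or each psi_i vanishes on Y, adding
   alternately vectors whose span is dense modulo Y and functionals that are
   total on Y; the closed span of the u_i of the second kind is a quasicomplement.

   In the reflexive case (Lindenstrauss) the sets of pairs in X x X^* that are
   stable under suitable countably many Skolem functions carry norm-one
   projections preserving Y. Along a well-ordering of X these projections
   increase continuously, and quasicomplements in the ranges of their increments
   add up to one in X. The increments are treated by transfinite induction on the
   generating initial segment, down to the countably generated ones, whose range
   is separable.

   Infinite alpha. Perturbing a Hamel basis of an alpha-dimensional subspace gives
   another alpha-dimensional subspace F and a vector y in the closure of F but not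
   in F; no closed subspace containing F meets the line through y trivially. *)

Set Implicit Arguments.
Unset Strict Implicit.
Unset Printing Implicit Defensive.

Import Order.TTheory GRing.Theory Num.Theory.
Import numFieldNormedType.Exports.

Local Open Scope classical_set_scope.
Local Open Scope card_scope.
Local Open Scope ring_scope.

(** * Real and complex scalars treated together *)

Section Scalars.
Variables (R : realType) (s : scalars).

(** Norms of [X] take values in the scalar field, real or complex; the argument is therefore run on
    an abstract space with a real-valued norm [nu], whose dual is represented by a space [D] paired
    with it through [ev], so that vectors and functionals can be handled in one set of pairs. The
    first members of such a set span the range of a projection, the second members cut out its
    kernel. A norming functional for every vector of the set makes the projection contractive; an
    almost norming vector for every functional makes range and kernel fill the space, and there
    reflexivity enters. Norming vectors taken inside [Y] make the projection preserve [Y]: an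
    increment then sends a common vector of [Y] and of the assembled subspace to a common vector of
    [Y] and of a single piece. An increment is split in its turn by sets of pairs closed under it
    and its adjoint, since their projections commute with it. For finite alpha, the infinite
    codimension of [Y] enters through the requirement that [Z/F] be infinite dimensional. For
    infinite alpha, the offending [Y] is a mere line. *)

Definition of_real : R -> scalar_field R s :=
  match s with
  | RealScalars => fun r => r
  | ComplexScalars => fun r => (r%:C)%C
  end.

Definition real_part : scalar_field R s -> R :=
  match s with
  | RealScalars => fun a => a
  | ComplexScalars => fun a => complex.Re a
  end.

Definition modulus (a : scalar_field R s) : R := real_part `|a|.

Lemma of_realD : {morph of_real : r t / r + t}.
Proof. by rewrite /of_real; case: s => // r t; rewrite rmorphD. Qed.

Lemma of_realM : {morph of_real : r t / r * t}.
Proof. by rewrite /of_real; case: s => // r t; rewrite rmorphM. Qed.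

Lemma of_realN : {morph of_real : r / - r}.
Proof. by rewrite /of_real; case: s => // r; rewrite rmorphN. Qed.

Lemma of_real0 : of_real 0 = 0.
Proof. by rewrite /of_real; case: s. Qed.

Lemma of_real1 : of_real 1 = 1.
Proof. by rewrite /of_real; case: s. Qed.

Lemma of_real_le r t : (of_real r <= of_real t) = (r <= t).
Proof. by rewrite /of_real; case: s => //; rewrite lecR. Qed.

Lemma of_real_lt r t : (of_real r < of_real t) = (r < t).
Proof. by rewrite /of_real; case: s => //; rewrite ltcR. Qed.

Lemma of_realK : cancel of_real real_part.
Proof. by rewrite /of_real /real_part; case: s. Qed.

Lemma real_partK (e : scalar_field R s) : 0 <= e -> of_real (real_part e) = e.
Proof.
rewrite /real_part /of_real; case: s e => //= -[x y].
by rewrite lecE /= => /andP[/eqP-> _].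
Qed.

Lemma modulusE a : of_real (modulus a) = `|a|.
Proof. exact: real_partK. Qed.

Lemma of_real_norm r : `|of_real r| = of_real `|r|.
Proof.
by rewrite /of_real; case: s => //=; rewrite normc_def /= expr0n addr0 sqrtr_sqr.
Qed.

Lemma modulus_of_real r : modulus (of_real r) = `|r|.
Proof. by rewrite /modulus of_real_norm of_realK. Qed.

Lemma of_real_inj : injective of_real.
Proof. exact: can_inj of_realK. Qed.

Lemma modulus_ge0 a : 0 <= modulus a.
Proof. by rewrite -of_real_le of_real0 modulusE. Qed.

Lemma modulusM a b : modulus (a * b) = modulus a * modulus b.
Proof. by apply: of_real_inj; rewrite of_realM !modulusE normrM. Qed.

Lemma modulusD a b : modulus (a + b) <= modulus a + modulus b.
Proof. by rewrite -of_real_le of_realD !modulusE ler_normD. Qed.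

Lemma modulusN a : modulus (- a) = modulus a.
Proof. by rewrite /modulus normrN. Qed.

Lemma modulus0 : modulus 0 = 0.
Proof. by apply: of_real_inj; rewrite modulusE normr0 of_real0. Qed.

Lemma modulus1 : modulus 1 = 1.
Proof. by apply: of_real_inj; rewrite modulusE normr1 of_real1. Qed.

Lemma modulus_eq0 a : modulus a = 0 -> a = 0.
Proof. by move=> h; apply: normr0_eq0; rewrite -modulusE h of_real0. Qed.

Lemma modulusV a : modulus a^-1 = (modulus a)^-1.
Proof.
have [->|a0] := eqVneq a 0; first by rewrite invr0 modulus0 invr0.
have m0 : modulus a != 0.
  by apply: contra_neq a0 => /modulus_eq0.
by apply: (mulIf m0); rewrite -modulusM !mulVf // modulus1.
Qed.

Lemma real_part_le a : real_part a <= modulus a.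
Proof.
rewrite /modulus /real_part; case: s a => [a|[x y]]; first exact: ler_norm.
rewrite normc_def /=; apply: (le_trans (ler_norm _)).
by rewrite -sqrtr_sqr ler_sqrt ?addr_ge0 ?sqr_ge0 // lerDl sqr_ge0.
Qed.

(** Rationals, or pairs of rationals as real and imaginary parts. Sets closed under these multiples
    alone can stay countable. *)
Lemma scalars_separable : exists q : nat -> scalar_field R s,
  forall a e, 0 < e -> exists n, modulus (a - q n) < e.
Proof.
have key (x e : R) : 0 < e -> exists u : rat, `|x - ratr u| < e.
  move=> e0; have /rat_in_itvoo[u] : x - e < x + e by lra.
  rewrite in_itv /= => /andP[h1 h2]; exists u; rewrite ltr_norml; lra.
rewrite /modulus /real_part; case: s => /=.
  exists (fun n => if unpickle n is Some u then ratr u else 0) => a e e0.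
  by have [u hu] := key a e e0; exists (pickle u); rewrite pickleK.
exists (fun n => if unpickle n is Some (u, v)
  then Complex (ratr u) (ratr v) else 0) => -[x y] e e0.
have e2 : 0 < e / 2 by lra.
have [u hu] := key x _ e2; have [v hv] := key y _ e2.
exists (pickle (u, v)); rewrite pickleK /=.
set a := x - _; set b := y - _.
have -> : e = Num.sqrt (e ^+ 2) by rewrite sqrtr_sqr gtr0_norm.
rewrite ltr_sqrt ?exprn_gt0 //.
rewrite -(real_normK (num_real a)) -(real_normK (num_real b)).
have := normr_ge0 a; have := normr_ge0 b; rewrite -/a in hu; rewrite -/b in hv.
by move: `|a| `|b| hu hv => A B *; nra.
Qed.

End Scalars.

(** * Sublinear functionals and the real Hahn-Banach theorem *)

Section HahnBanach.
Variables (R : realType) (s : scalars).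
Local Notation K := (scalar_field R s).
Variable V : lmodType K.
Local Notation "r ·: x" := (of_real s r *: x) (at level 40).

Definition sublinear (q : V -> R) :=
  (forall x y, q (x + y) <= q x + q y) /\
  (forall r x, 0 < r -> q (r ·: x) <= r * q x).

Lemma sublinearZ q r x : sublinear q -> 0 < r -> q (r ·: x) = r * q x.
Proof.
move=> [_ qZ] r0; apply/eqP; rewrite eq_le qZ //=.
have rV0 : 0 < r^-1 by rewrite invr_gt0.
have := qZ _ (r ·: x) rV0.
rewrite scalerA -of_realM mulVf ?gt_eqF // of_real1 scale1r => h.
by rewrite -(ler_pM2l rV0) mulrA mulVf ?gt_eqF // mul1r.
Qed.

Lemma sublinear0 q : sublinear q -> q 0 = 0.
Proof.
move=> sq; have := @sublinearZ q 2 0 sq ltac:(lra); rewrite scaler0; lra.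
Qed.

Lemma sublinear_geN q x : sublinear q -> - q (- x) <= q x.
Proof.
by move=> sq; have := sq.1 x (- x); rewrite subrr sublinear0 //; lra.
Qed.

(* Replacing [q] by its infimum along the ray through [y] keeps it sublinear;
   a minimal sublinear functional is therefore additive. *)
Definition ray_inf (q : V -> R) (y x : V) : R :=
  inf [set q (x + t ·: y) - t * q y | t in [set t | 0 <= t]].

Lemma ray_inf_lbound q y x : sublinear q ->
  lbound [set q (x + t ·: y) - t * q y | t in [set t | 0 <= t]] (- q (- x)).
Proof.
move=> sq _ [t /= t0 <-].
have : q (t ·: y) = t * q y.
  have [->|t1] := eqVneq t 0.
    by rewrite of_real0 scale0r sublinear0 // mul0r.
  by apply: sublinearZ => //; rewrite lt_def t1.
have := sq.1 (x + t ·: y) (- x); rewrite addrAC subrr add0r; lra.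
Qed.

Lemma ray_inf_le q y x t : sublinear q -> 0 <= t ->
  ray_inf q y x <= q (x + t ·: y) - t * q y.
Proof.
move=> sq t0; apply: ge_inf; last by exists t.
by exists (- q (- x)); exact: ray_inf_lbound.
Qed.

Lemma ray_inf_ge q y x c :
  (forall t, 0 <= t -> c <= q (x + t ·: y) - t * q y) -> c <= ray_inf q y x.
Proof.
move=> h; apply: lb_le_inf; first by exists (q (x + 0 ·: y) - 0 * q y); exists 0 => /=.
by move=> _ [t /= t0 <-]; exact: h.
Qed.

Lemma ray_inf_sublinear q y : sublinear q -> sublinear (ray_inf q y).
Proof.
move=> sq; split=> [x x'|r x r0].
  rewrite -lerBlDr; apply: ray_inf_ge => t t0.
  rewrite lerBlDr -lerBlDl; apply: ray_inf_ge => t' t'0; rewrite lerBlDl.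
  apply: (le_trans (ray_inf_le y (x + x') sq (addr_ge0 t0 t'0))).
  have := sq.1 (x + t ·: y) (x' + t' ·: y).
  by rewrite of_realD scalerDl addrACA; lra.
rewrite mulrC -ler_pdivrMr //; apply: ray_inf_ge => t t0.
rewrite ler_pdivrMr //.
have rt0 : 0 <= r * t by rewrite mulr_ge0 // ltW.
apply: (le_trans (ray_inf_le y (r ·: x) sq rt0)).
by rewrite of_realM -scalerA -scalerDr sublinearZ //; lra.
Qed.

Lemma ray_inf_le_id q y x : sublinear q -> ray_inf q y x <= q x.
Proof.
move=> sq; have := ray_inf_le y x sq (lexx 0).
by rewrite of_real0 scale0r mul0r addr0 subr0.
Qed.

(** Zorn's lemma for the reversed pointwise order. A chain is bounded by its pointwise infimum,
    which is finite because [q <= p] forces [q x >= - p (- x)], and subadditive because two members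
    of the chain are comparable. *)
Lemma minimal_sublinear p : sublinear p ->
  exists q, [/\ sublinear q, forall x, q x <= p x &
    forall q', sublinear q' -> (forall x, q' x <= q x) -> q' = q].
Proof.
move=> sp.
pose P q := sublinear q /\ forall x, q x <= p x.
pose T := {q : V -> R | P q}.
pose le_T (q q' : T) : bool := `[< forall x, sval q' x <= sval q x >].
have pT : P p by [].
have [||||[q [sq qp]] qmax] := @Zorn T le_T.
- by move=> q; apply/asboolP.
- move=> q1 q2 q3 /asboolP h1 /asboolP h2; apply/asboolP => x.
  exact: le_trans (h2 x) (h1 x).
- move=> [q1 h1] [q2 h2] /asboolP /= h /asboolP /= h'; apply: eq_exist.
  by apply/funext => x; apply/eqP; rewrite eq_le h h'.
- move=> C Ctot.
  have [[q0 Cq0]|C0] := pselect (exists q, C q); last first.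
    by exists (exist P p pT) => q Cq; case: C0; exists q.
  pose S x := [set sval q x | q in C].
  have Slb x : lbound (S x) (- p (- x)).
    move=> _ [[q [sq qp]] Cq <-] /=; apply: le_trans (sublinear_geN _ sq).
    by rewrite lerN2.
  have Sle q x : C q -> inf (S x) <= sval q x.
    by move=> Cq; apply: ge_inf; [exists (- p (- x))|exists q].
  have Sge x c : (forall q, C q -> c <= sval q x) -> c <= inf (S x).
    move=> h; apply: lb_le_inf; first by exists (sval q0 x); exists q0.
    by move=> _ [q Cq <-]; exact: h.
  have sS : sublinear (fun x => inf (S x)).
    split=> [x y|r x r0].
      rewrite -lerBlDr; apply: (Sge _) => q Cq.
      rewrite lerBlDr -lerBlDl; apply: Sge => q' Cq'; rewrite lerBlDl.
      have [|] := Ctot _ _ Cq Cq' => /asboolP h.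
        apply: (le_trans (Sle _ _ Cq')).
        by have := (svalP q').1.1 x y; have := h x; lra.
      apply: (le_trans (Sle _ _ Cq)).
      by have := (svalP q).1.1 x y; have := h y; lra.
    rewrite mulrC -ler_pdivrMr //; apply: (Sge _) => q Cq.
    rewrite ler_pdivrMr // mulrC; apply: (le_trans (Sle _ _ Cq)).
    exact: (svalP q).1.2.
  have Sp x : inf (S x) <= p x.
    exact: le_trans (Sle _ _ Cq0) ((svalP q0).2 x).
  have iT : P (fun x => inf (S x)) by [].
  exists (exist P _ iT) => q Cq; apply/asboolP => x /=.
  exact: Sle.
exists q; split=> // q' sq' q'q.
have q'p x : q' x <= p x by exact: le_trans (q'q x) (qp x).
have := qmax (exist P q' (conj sq' q'p)).
by move=> /(_ ltac:(exact/asboolP)) /(congr1 sval).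
Qed.

(** The minimal [u] is taken below [ray_inf p x0] instead of [p]: at [- x0] with [t = 1] this reads
    [u (- x0) <= - p x0], which forces equality at [x0]. *)
Lemma real_hahn_banach p x0 : sublinear p ->
  exists u : V -> R, [/\ {morph u : x y / x + y},
    forall r x, u (r ·: x) = r * u x, forall x, u x <= p x & u x0 = p x0].
Proof.
move=> sp; have [u [su up umin]] := minimal_sublinear (ray_inf_sublinear x0 sp).
have uray y : ray_inf u y = u.
  apply: umin; first exact: ray_inf_sublinear.
  by move=> x; exact: ray_inf_le_id.
have uD : {morph u : x y / x + y}.
  move=> x y; apply/eqP; rewrite eq_le su.1 /=.
  have := @ray_inf_le u y x 1 su ltac:(lra).
  by rewrite uray of_real1 scale1r; lra.
have uN x : u (- x) = - u x.
  by have := uD x (- x); rewrite subrr sublinear0 //; lra.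
have up' x : u x <= p x by exact: le_trans (up x) (ray_inf_le_id _ _ sp).
exists u; split=> //.
  move=> r x; have [r0|r0|->] := ltrgt0P r; last 1 first.
  - by rewrite of_real0 scale0r mul0r sublinear0.
  - exact: sublinearZ.
  - rewrite -[r]opprK of_realN scaleNr uN sublinearZ ?oppr_gt0 //; lra.
apply/eqP; rewrite eq_le up' /=.
have := up (- x0); have := @ray_inf_le p x0 (- x0) 1 sp ltac:(lra).
by rewrite of_real1 scale1r addNr sublinear0 // uN; lra.
Qed.

Definition seminorm (nu : V -> R) :=
  (forall x y, nu (x + y) <= nu x + nu y) /\
  (forall a x, nu (a *: x) = modulus a * nu x).

End HahnBanach.

(** * Scalar-valued functionals, closures and separation *)

Section Functionals.
Variables (R : realType) (s : scalars).
Local Notation K := (scalar_field R s).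
Variable V : lmodType K.

Definition functional (f : V -> K) :=
  forall a x y, f (a *: x + y) = a * f x + f y.

Lemma functional0 f : functional f -> f 0 = 0.
Proof.
by move=> lf; have := lf (-1) 0 0; rewrite scaler0 addr0 mulN1r addNr.
Qed.

Lemma functionalD f x y : functional f -> f (x + y) = f x + f y.
Proof. by move=> lf; have := lf 1 x y; rewrite scale1r mul1r. Qed.

Lemma functionalZ f a x : functional f -> f (a *: x) = a * f x.
Proof. by move=> lf; have := lf a x 0; rewrite addr0 functional0 // addr0. Qed.

Lemma functionalN f x : functional f -> f (- x) = - f x.
Proof. by move=> lf; rewrite -scaleN1r functionalZ // mulN1r. Qed.

Lemma functionalB f x y : functional f -> f (x - y) = f x - f y.
Proof. by move=> lf; rewrite functionalD // functionalN. Qed.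

Lemma seminorm_sublinear (nu : V -> R) : seminorm nu -> sublinear nu.
Proof.
move=> [nuD nuZ]; split=> // r x r0.
by rewrite nuZ modulus_of_real gtr0_norm.
Qed.

Lemma seminorm0 (nu : V -> R) : seminorm nu -> nu 0 = 0.
Proof. by move=> /seminorm_sublinear/sublinear0. Qed.

Lemma seminormN (nu : V -> R) x : seminorm nu -> nu (- x) = nu x.
Proof. by move=> [_ nuZ]; rewrite -scaleN1r nuZ modulusN modulus1 mul1r. Qed.

Lemma seminorm_ge0 (nu : V -> R) x : seminorm nu -> 0 <= nu x.
Proof.
by move=> h; have := h.1 x (- x); rewrite subrr seminorm0 // seminormN //; lra.
Qed.

Lemma seminormB (nu : V -> R) x y : seminorm nu -> nu (x - y) <= nu x + nu y.
Proof. by move=> h; rewrite -(seminormN y h); exact: h.1. Qed.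

Lemma seminorm_distC (nu : V -> R) x y : seminorm nu -> nu (x - y) = nu (y - x).
Proof. by move=> h; rewrite -(seminormN _ h) opprB. Qed.

Lemma functional_of_real_part (u : V -> R) : {morph u : x y / x + y} ->
  (forall r x, u (of_real s r *: x) = r * u x) ->
  exists2 f, functional f & forall x, real_part (f x) = u x.
Proof.
rewrite /functional /real_part /of_real.
case: s V u => /= W u uD uZ.
  by exists u => // a x y; rewrite uD uZ.
(* A complex linear functional is recovered from its real part [u] as [u(x) - i u(ix)]. *)
exists (fun x => Complex (u x) (- u ('i%C *: x))) => // -[a b] x y.
have ab : Complex a b = (a%:C + 'i * b%:C)%C :> R[i].
  by apply/eqP; rewrite eq_complex /=; apply/andP; split; apply/eqP; lra.
have ii : (a%:C *: ('i *: x) + ('i * 'i * b%:C) *: x)%C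
   = ('i *: (Complex a b *: x))%C.
  rewrite scalerA -scalerDl scalerA; congr (_ *: _); rewrite ab; ring.
have i2 : ('i * 'i : R[i])%C = -1.
  by apply/eqP; rewrite eq_complex /=; apply/andP; split; apply/eqP; lra.
apply/eqP; rewrite eq_complex /= !uD scalerDr uD -ii uD i2 mulN1r.
rewrite -rmorphN !uZ ab scalerDl [('i * _)%C]mulrC -scalerA uD !uZ.
by apply/andP; split; apply/eqP; ring.
Qed.

(** A modulus bounded by the real part leaves no room for an imaginary part; this upgrades the
    equality at [x0] from real parts to scalars. *)
Lemma real_modulus (z : K) m : real_part z = m -> modulus z <= m ->
  z = of_real s m.
Proof.
move=> zm mz; have {mz} : `|z| = of_real s m.
  rewrite -modulusE; congr (of_real s _); apply/eqP; rewrite eq_le mz /=.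
  by rewrite -zm real_part_le.
rewrite -{}zm; move: z; rewrite /real_part /of_real.
case: s => [//|[x y]] /=.
move=> h; apply/eqP; rewrite eq_complex /= eqxx /=.
move: h; rewrite normc_def /= => -[] h.
have : x ^+ 2 + y ^+ 2 = x ^+ 2.
  by rewrite -{2}h sqr_sqrtr // addr_ge0 ?sqr_ge0.
by move=> h2; rewrite -sqrf_eq0; apply/eqP; lra.
Qed.

Lemma hahn_banach (nu : V -> R) x0 : seminorm nu ->
  exists f, [/\ functional f, forall x, modulus (f x) <= nu x &
    f x0 = of_real s (nu x0)].
Proof.
move=> snu.
have [u [uD uZ unu ux0]] := real_hahn_banach x0 (seminorm_sublinear snu).
have [f lf fu] := functional_of_real_part uD uZ.
have fnu x : modulus (f x) <= nu x.
  have [->|fx0] := eqVneq (f x) 0; first by rewrite modulus0 seminorm_ge0.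
  have m0 : modulus (f x) != 0 by apply: contra_neq fx0 => /modulus_eq0.
  (* A scalar of modulus one for which [f (a *: x)] is the modulus of [f x], so that the bound on
     real parts applies. *)
  pose a := of_real s (modulus (f x)) / f x.
  have a1 : modulus a = 1.
    by rewrite modulusM modulusV modulus_of_real ger0_norm ?modulus_ge0 // divff.
  have := unu (a *: x); rewrite -fu functionalZ // snu.2 a1 mul1r.
  by rewrite divfK // of_realK.
exists f; split=> //; apply: real_modulus; first by rewrite fu.
exact: fnu.
Qed.

Definition linear_subspace (S : set V) :=
  S 0 /\ forall a x y, S x -> S y -> S (a *: x + y).

Lemma subspaceD S x y : linear_subspace S -> S x -> S y -> S (x + y).
Proof. by move=> [_ h] Sx Sy; rewrite -[x]scale1r; exact: h. Qed.

Lemma subspaceZ S a x : linear_subspace S -> S x -> S (a *: x).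
Proof. by move=> [S0 h] Sx; rewrite -[_ *: _]addr0; exact: h. Qed.

Lemma subspaceN S x : linear_subspace S -> S x -> S (- x).
Proof. by move=> h Sx; rewrite -scaleN1r; exact: subspaceZ. Qed.

Lemma subspaceB S x y : linear_subspace S -> S x -> S y -> S (x - y).
Proof. by move=> h Sx Sy; apply: subspaceD => //; exact: subspaceN. Qed.

Lemma subspace_sum S (I : eqType) (r : seq I) (F : I -> V) : linear_subspace S ->
  (forall i, i \in r -> S (F i)) -> S (\sum_(i <- r) F i).
Proof.
move=> sS h; rewrite big_seq; elim/big_ind: _ => //; first exact: sS.1.
by move=> x y; exact: subspaceD.
Qed.

Definition nclosure (nu : V -> R) (S : set V) : set V :=
  [set x | forall e, 0 < e -> exists2 y, S y & nu (x - y) < e].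

Variable nu : V -> R.
Hypothesis snu : seminorm nu.

Lemma sub_nclosure S : S `<=` nclosure nu S.
Proof. by move=> x Sx e e0; exists x => //; rewrite subrr seminorm0. Qed.

Lemma nclosureS S T : S `<=` T -> nclosure nu S `<=` nclosure nu T.
Proof. by move=> ST x h e /h[y Sy]; exists y => //; exact: ST. Qed.

Lemma nclosure_idem S : nclosure nu (nclosure nu S) `<=` nclosure nu S.
Proof.
move=> x h e e0; have e2 : 0 < e / 2 by lra.
have [y /(_ _ e2)[z Sz yz] xy] := h _ e2; exists z => //.
by have := snu.1 (x - y) (y - z); rewrite addrA subrK; lra.
Qed.

(* The set [S] is only assumed stable under the scalars of a countable dense
   set, so that it may itself be countable. *)
Lemma nclosure_subspace S (q : nat -> K) :
  (forall a e, 0 < e -> exists n, modulus (a - q n) < e) ->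
  S 0 -> (forall n x y, S x -> S y -> S (q n *: x + y)) ->
  linear_subspace (nclosure nu S).
Proof.
move=> qd S0 Sq; split; first exact: sub_nclosure.
move=> a x y hx hy e e0; have e3 : 0 < e / 3 by lra.
have ma : 0 < modulus a + 1 by have := modulus_ge0 a; lra.
have [x' Sx' xx'] := hx _ (divr_gt0 e3 ma).
have [y' Sy' yy'] := hy _ e3.
have nx : 0 < nu x' + 1 by have := seminorm_ge0 x' snu; lra.
have [n qn] := qd a _ (divr_gt0 e3 nx).
exists (q n *: x' + y'); first exact: Sq.
have -> : a *: x + y - (q n *: x' + y') =
   (a *: (x - x') + (a - q n) *: x') + (y - y').
  by rewrite scalerBr scalerBl [X in _ = X + _]addrA subrK opprD addrACA.
have h1 := snu.1 (a *: (x - x') + (a - q n) *: x') (y - y').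
have h2 := snu.1 (a *: (x - x')) ((a - q n) *: x').
move: h1 h2; rewrite !snu.2 => h1 h2.
have h3 : modulus a * nu (x - x') <= e / 3.
  rewrite ltr_pdivlMr // in xx'.
  by have := seminorm_ge0 (x - x') snu; have := modulus_ge0 a; nra.
have h4 : modulus (a - q n) * nu x' <= e / 3.
  rewrite ltr_pdivlMr // in qn.
  by have := seminorm_ge0 x' snu; have := modulus_ge0 (a - q n); nra.
lra.
Qed.

Lemma nclosure_subspace_subspace S : linear_subspace S -> linear_subspace (nclosure nu S).
Proof.
move=> sS; have [q qd] := @scalars_separable R s.
by apply: (nclosure_subspace qd); [exact: sS.1|move=> n; exact: sS.2].
Qed.

(** Hahn-Banach for the distance to [S], a seminorm that is below [nu], null on [S] and positive at
    [x0]. *)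
Lemma hahn_banach_separation S x0 : linear_subspace S -> ~ nclosure nu S x0 ->
  exists f, [/\ functional f, forall x, modulus (f x) <= nu x,
    forall x, S x -> f x = 0 & f x0 <> 0].
Proof.
move=> sS Sx0.
pose d x := inf [set nu (x - y) | y in S].
have d_le x y : S y -> d x <= nu (x - y).
  move=> Sy; apply: ge_inf; last by exists y.
  by exists 0 => _ [z _ <-]; exact: seminorm_ge0.
have d_ge x c : (forall y, S y -> c <= nu (x - y)) -> c <= d x.
  move=> h; apply: lb_le_inf; last by move=> _ [y Sy <-]; exact: h.
  by exists (nu (x - 0)); exists 0 => //; exact: sS.1.
have d0 x : 0 <= d x by apply: (d_ge _ _) => y _; exact: seminorm_ge0.
have dZ a x : a != 0 -> d (a *: x) <= modulus a * d x.
  move=> a0; have ma : 0 < modulus a.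
    by rewrite lt_def modulus_ge0 andbT; apply: contra_neq a0 => /modulus_eq0.
  rewrite mulrC -ler_pdivrMr //; apply: (d_ge _ _) => y Sy.
  rewrite ler_pdivrMr // mulrC -snu.2 scalerBr; apply: (d_le _ _).
  exact: subspaceZ.
have sd : seminorm d.
  split=> [x y|a x].
    rewrite -lerBlDr; apply: (d_ge _ _) => x' Sx'.
    rewrite lerBlDr -lerBlDl; apply: (d_ge _ _) => y' Sy'; rewrite lerBlDl.
    apply: (le_trans (d_le _ (x' + y') _)); first exact: subspaceD.
    by rewrite opprD addrACA snu.1.
  have [->|a0] := eqVneq a 0.
    rewrite scale0r modulus0 mul0r; apply/eqP; rewrite eq_le d0 andbT.
    by have := d_le 0 0 sS.1; rewrite subrr (seminorm0 snu).
  apply/eqP; rewrite eq_le dZ //=.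
  have ma : 0 < modulus a.
    by rewrite lt_def modulus_ge0 andbT; apply: contra_neq a0 => /modulus_eq0.
  have := @dZ a^-1 (a *: x); rewrite invr_eq0 => /(_ a0).
  by rewrite scalerA mulVf // scale1r modulusV mulrC ler_pdivlMr // mulrC.
have [f [lf fd fx0]] := hahn_banach x0 sd.
exists f; split=> //.
- move=> x; apply: (le_trans (fd x)); rewrite -[in leRHS](subr0 x).
  exact: d_le sS.1.
- move=> x Sx; apply: modulus_eq0; apply/eqP; rewrite eq_le modulus_ge0 andbT.
  apply: (le_trans (fd x)); apply: (le_trans (d_le x x Sx)).
  by rewrite subrr (seminorm0 snu).
- rewrite fx0 => /(congr1 (@modulus R s)); rewrite modulus_of_real modulus0.
  rewrite ger0_norm // => dx0; apply: Sx0 => e e0.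
  apply: contrapT => h; have : e <= d x0.
    apply: (d_ge _ _) => y Sy; rewrite leNgt; apply/negP => ye.
    by apply: h; exists y.
  by lra.
Qed.

End Functionals.

Section Span.
Variables (R : realType) (s : scalars) (V : lmodType (scalar_field R s)).

Definition lspan (A : set V) : set V :=
  [set x | forall S, linear_subspace S -> A `<=` S -> S x].

Lemma lspan_subspace A : linear_subspace (lspan A).
Proof.
split; first by move=> S [].
by move=> a x y hx hy S sS AS; apply: sS.2; [exact: hx|exact: hy].
Qed.

Lemma sub_lspan A : A `<=` lspan A.
Proof. by move=> x Ax S _; exact. Qed.

Lemma lspan_min A S : linear_subspace S -> A `<=` S -> lspan A `<=` S.
Proof. by move=> sS AS x; exact. Qed.

End Span.

(** Recursion whose step [n] sees all earlier values. The history is read from a finite list with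
    default [t0], hence the hypothesis that [P n p] depends only on the values of [p] below [n]. *)
Lemma strong_dependent_choice (T : Type) (t0 : T)
    (P : nat -> (nat -> T) -> T -> Prop) :
  (forall n p p' t, (forall i, (i < n)%N -> p i = p' i) ->
    P n p t -> P n p' t) ->
  (forall n p, (forall m, (m < n)%N -> P m p (p m)) -> exists t, P n p t) ->
  exists p, forall n, P n p (p n).
Proof.
move=> Pext Pex.
have [c hc] : exists c : nat -> (nat -> T) -> T,
    forall n p, (exists t, P n p t) -> P n p (c n p).
  have h n p : exists t, (exists t, P n p t) -> P n p t.
    by have [[t Pt]|] := pselect (exists t, P n p t); [exists t|exists t0].
  have [c hc] := choice (fun np : nat * (nat -> T) => h np.1 np.2).
  by exists (fun n p => c (n, p)) => n p; exact: hc (n, p).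
pose F := fix F n : seq T :=
  if n is m.+1 then rcons (F m) (c m (nth t0 (F m))) else [::].
have sF n : size (F n) = n by elim: n => //= n IH; rewrite size_rcons IH.
pose p n := c n (nth t0 (F n)).
have nF n i : (i < n)%N -> nth t0 (F n) i = p i.
  elim: n => //= n IH; rewrite nth_rcons sF ltnS leq_eqVlt => /orP[/eqP->|lt].
    by rewrite ltnn eqxx.
  by rewrite lt IH.
exists p; elim/ltn_ind => n IH.
have [t Pt] := Pex n p IH.
refine (Pext n (nth t0 (F n)) p (p n) (nF n) _).
by apply: hc; exists t; refine (Pext n p _ t _ Pt) => i lt; rewrite nF.
Qed.

(** * Quasicomplements inside separable subspaces *)

Section Mackey.
Variables (R : realType) (s : scalars).
Local Notation K := (scalar_field R s).
Variable V : lmodType K.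
Variable nu : V -> R.
Hypothesis snu : seminorm nu.
Hypothesis nu_eq0 : forall x, nu x = 0 -> x = 0.

Definition bounded_functional (f : V -> K) :=
  functional f /\ exists M, forall x, modulus (f x) <= M * nu x.

Lemma bounded_functional_sum (n : nat) (a : 'I_n -> K) (f : 'I_n -> V -> K) g :
  bounded_functional g -> (forall i, bounded_functional (f i)) ->
  bounded_functional (fun x => g x - \sum_(i < n) a i * f i x).
Proof.
elim: n a f => [|n IH] a f hg hf.
  suff -> : (fun x => g x - \sum_(i < 0) a i * f i x) = g by [].
  by apply/funext => x; rewrite big_ord0 subr0.
pose w := widen_ord (leqnSn n).
have [] := IH (a \o w) (f \o w) hg (fun i => hf (w i)).
set h := (X in functional X) => l [M hM].
have [lf [N hN]] := hf ord_max.
have -> : (fun x => g x - \sum_(i < n.+1) a i * f i x) =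
    (fun x => h x - a ord_max * f ord_max x).
  by apply/funext => x; rewrite big_ord_recr /= opprD addrA.
split.
  by move=> b x y; rewrite l lf; ring.
exists (M + modulus (a ord_max) * N) => x.
apply: (le_trans (modulusD _ _)); rewrite modulusN modulusM mulrDl; apply: lerD.
- exact: hM.
- by rewrite -mulrA ler_wpM2l ?modulus_ge0.
Qed.

Lemma functional_sum (n : nat) (a : 'I_n -> K) (u : 'I_n -> V) (f : V -> K) :
  functional f -> f (\sum_(i < n) a i *: u i) = \sum_(i < n) a i * f (u i).
Proof.
move=> lf; elim: n a u => [|n IH] a u; first by rewrite !big_ord0 functional0.
by rewrite !big_ord_recr /= functionalD // functionalZ // IH.
Qed.

Lemma bounded_functional_kernel (f : V -> K) S : bounded_functional f ->
  (forall x, S x -> f x = 0) -> forall x, nclosure nu S x -> f x = 0.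
Proof.
move=> [lf [M hM]] fS x Sx; apply: modulus_eq0; apply/eqP.
rewrite eq_le modulus_ge0 andbT; apply/ler_addgt0Pl => e e0; rewrite addr0.
have M0 : 0 < `|M| + 1 by have := normr_ge0 M; lra.
have [y Sy xy] := Sx _ (divr_gt0 e0 M0).
have -> : f x = f (x - y) by rewrite functionalB // (fS y) // subr0.
apply: (le_trans (hM _)); rewrite ltr_pdivlMr // in xy.
have := ler_norm M; have := seminorm_ge0 (x - y) snu; nra.
Qed.

(** The version relative to a closed subspace [W] serves for the ranges of the increments. The
    functionals [g n] norm a dense sequence of [W], hence separate its points; so a vector of [Y]
    and [W] killed by all the second members vanishes once each [g n] agrees on [Y] and [W] with a
    combination of them. *)
Lemma separable_quasicomplement (Y W : set V) (w : nat -> V) :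
  linear_subspace Y -> nclosure nu Y `<=` Y ->
  linear_subspace W -> nclosure nu W `<=` W ->
  (forall n, W (w n)) -> W `<=` nclosure nu (range w) ->
  exists Z, [/\ linear_subspace Z, nclosure nu Z `<=` Z, Z `<=` W,
    forall x, Z x -> Y x -> x = 0 &
    forall x, W x ->
      nclosure nu [set y + z | y in Y `&` W & z in Z] x].
Proof.
move=> sY cY sW cW Ww wd.
have [g hg] : exists g : nat -> V -> K, forall n,
    [/\ functional (g n), forall x, modulus (g n x) <= nu x &
      g n (w n) = of_real s (nu (w n))].
  have [g hg] := choice (fun n => hahn_banach (w n) snu).
  by exists g.
have bg n : bounded_functional (g n).
  by have [lg gle _] := hg n; split=> //; exists 1 => x; rewrite mul1r.
(* As in the Gram-Schmidt process: [resx] is killed by the first [n] functionals, and [resf] kills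
   the first [n] vectors. *)
pose resx (p : nat -> V * (V -> K)) n x := x - \sum_(i < n) (p i).2 x *: (p i).1.
pose resf (p : nat -> V * (V -> K)) n f x :=
  f x - \sum_(i < n) f (p i).1 * (p i).2 x.
(* Step [2k] deals with [w k], step [2k + 1] with [g k]. The pair [(0, 0)] is a dummy for a step
   with nothing to add. *)
pose P n (p : nat -> V * (V -> K)) (t : V * (V -> K)) :=
  [/\ W t.1 /\ bounded_functional t.2,
    Y t.1 \/ (forall y, Y y -> t.2 y = 0),
    (forall i, (i < n)%N -> (p i).2 t.1 = 0 /\ t.2 (p i).1 = 0),
    t.2 t.1 = 1 \/ (t.1 = 0 /\ forall x, t.2 x = 0) &
    if odd n then exists c, forall y, Y y -> W y ->
      resf p n (g n./2) y = c * t.2 y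
    else exists c, Y (resx p n (w n./2) - c *: t.1)].
have [p hp] : exists p, forall n, P n p (p n).
  apply: (@strong_dependent_choice _ (0, fun=> 0)).
    move=> n p p' t pp' [h1 h2 h3 h4 h5]; split=> //.
      by move=> i lt; rewrite -pp' //; exact: h3.
    have -> : resf p' n = resf p n.
      apply/funext => f; apply/funext => x; rewrite /resf; congr (_ - _).
      by apply: eq_bigr => i _; rewrite pp'.
    have -> // : resx p' n = resx p n.
    apply/funext => x; rewrite /resx; congr (_ - _).
    by apply: eq_bigr => i _; rewrite pp'.
  move=> n p hp.
  have b0 : bounded_functional (fun=> 0).
    split; first by move=> a x y; rewrite mulr0 addr0.
    by exists 0 => x; rewrite modulus0 mul0r.
  have bp (i : 'I_n) : bounded_functional (p i).2.
    by have [[]] := hp i (ltn_ord i).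
  have orth (i j : 'I_n) : i != j -> (p i).2 (p j).1 = 0.
    move=> ij; have [lt|gt|/val_inj eq] := ltngtP i j; last by rewrite eq eqxx in ij.
      by have [_ _ /(_ _ lt)[]] := hp j (ltn_ord j).
    by have [_ _ /(_ _ gt)[]] := hp i (ltn_ord i).
  have idx (i : 'I_n) x : (p i).2 x * (p i).2 (p i).1 = (p i).2 x.
    have [_ _ _ [->|[_ ->]] _] := hp i (ltn_ord i); first by rewrite mulr1.
    by rewrite mul0r.
  have idf (i : 'I_n) f : functional f ->
      f (p i).1 * (p i).2 (p i).1 = f (p i).1.
    move=> lf; have [_ _ _ [->|[-> _]] _] := hp i (ltn_ord i).
      by rewrite mulr1.
    by rewrite functional0 // mul0r.
  have resxE (j : 'I_n) x : (p j).2 (resx p n x) = 0.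
    have [lj _] := bp j.
    rewrite functionalB // functional_sum // (bigD1 j) //= idx big1 ?addr0 ?subrr //.
    by move=> i ij; rewrite orth 1?eq_sym // mulr0.
  have resfE (j : 'I_n) f : functional f -> resf p n f (p j).1 = 0.
    move=> lf; rewrite /resf (bigD1 j) //= idf // big1 ?addr0 ?subrr //.
    by move=> i ij; rewrite orth // mulr0.
  have brf f : bounded_functional f -> bounded_functional (resf p n f).
    by move=> bf; exact: (@bounded_functional_sum n _ (fun i => (p i).2)).
  have Wrx x : W x -> W (resx p n x).
    move=> Wx; apply: subspaceB => //; apply: subspace_sum => // i _.
    by apply: subspaceZ => //; have [[]] := hp i (ltn_ord i).
  (* A term subtracted from [y] is in [Y] since either its vector is, or its functional annihilates
     [Y] and the term is zero. The same alternative keeps [resf] of an annihilator of [Y] an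
     annihilator. *)
  have Yrx y : Y y -> Y (resx p n y).
    move=> Yy; apply: subspaceB => //; apply: subspace_sum => // i _.
    have [_ [Yi|Yi0] _ _ _] := hp i (ltn_ord i); first exact: subspaceZ.
    by rewrite Yi0 // scale0r; exact: sY.1.
  have Yrf f : functional f -> (forall y, Y y -> f y = 0) ->
      forall y, Y y -> resf p n f y = 0.
    move=> lf fY y Yy; rewrite /resf fY // big1 ?subr0 // => i _.
    have [_ [Yi|Yi0] _ _ _] := hp i (ltn_ord i); first by rewrite fY // mul0r.
    by rewrite Yi0 // mulr0.
  have res_res f x : functional f -> resf p n f (resx p n x) = f (resx p n x).
    by move=> lf; rewrite /resf big1 ?subr0 // => i _; rewrite resxE mulr0.
  have res_res' f x : functional f -> functional (resf p n f) ->
      resf p n f (resx p n x) = resf p n f x.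
    move=> lf lrf; rewrite functionalB // functional_sum // big1 ?subr0 // => i _.
    by rewrite resfE ?mulr0.
  have pair_step x f : W x -> bounded_functional f ->
      Y x \/ (forall y, Y y -> f y = 0) -> resf p n f (resx p n x) = 1 ->
      [/\ W (resx p n x) /\ bounded_functional (resf p n f),
        Y (resx p n x) \/ (forall y, Y y -> resf p n f y = 0),
        (forall i, (i < n)%N ->
          (p i).2 (resx p n x) = 0 /\ resf p n f (p i).1 = 0) &
        resf p n f (resx p n x) = 1].
    move=> Wx bf Yxf fx1; split=> //.
    - by split; [exact: Wrx|exact: brf].
    - by case: Yxf => h; [left; exact: Yrx|right; apply: Yrf => //; case: bf].
    - move=> i lt; split; first exact: (resxE (Ordinal lt)).
      by apply: (resfE (Ordinal lt)); case: bf.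
  have zero_step : [/\ W 0 /\ bounded_functional (fun=> 0),
        Y 0 \/ (forall y, Y y -> 0 = 0 :> K),
        (forall i, (i < n)%N -> (p i).2 0 = 0 /\ 0 = 0 :> K) &
        0 = 1 :> K \/ (0 = 0 :> V /\ forall x : V, 0 = 0 :> K)].
    split; [by split=> //; exact: sW.1|by left; exact: sY.1| |by right].
    by move=> i lt; rewrite functional0 //; have [] := bp (Ordinal lt).
  rewrite /P; case: (boolP (odd n)) => on.
    have [lg bg'] := bg n./2.
    have [h0|/existsNP[y /not_implyP[Yy /not_implyP[Wy hy]]]] :=
      pselect (forall y, Y y -> W y -> resf p n (g n./2) y = 0).
      exists (0, fun=> 0); have [z1 z2 z3 z4] := zero_step.
      split; [exact: z1|exact: z2|exact: z3|by right|].
      by exists 0 => y Yy Wy; rewrite h0 // mul0r.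
    have lr := (brf _ (bg n./2)).1.
    have [||||z1 z2 z3 z4] := @pair_step ((resf p n (g n./2) y)^-1 *: y) (g n./2).
    - exact: subspaceZ.
    - exact: bg.
    - by left; exact: subspaceZ.
    - by rewrite res_res' // functionalZ // mulVf //; apply/eqP.
    exists (resx p n ((resf p n (g n./2) y)^-1 *: y), resf p n (g n./2)).
    split; [exact: z1|exact: z2|exact: z3|by left|] => /=.
    by exists 1 => z _ _; rewrite mul1r.
  have [Yx|Yx] := pselect (Y (resx p n (w n./2))).
    exists (0, fun=> 0); have [z1 z2 z3 z4] := zero_step.
    split; [exact: z1|exact: z2|exact: z3|by right|].
    by exists 0; rewrite scaler0 subr0.
  have [f [lf fle fY fx]] :=
    hahn_banach_separation snu sY (fun h => Yx (cY _ h)).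
  have bf : bounded_functional f by split=> //; exists 1 => x; rewrite mul1r.
  pose c := (f (resx p n (w n./2)))^-1.
  have lcf : functional (fun x => c * f x) by move=> a x y; rewrite lf; ring.
  have bcf : bounded_functional (fun x => c * f x).
    split=> //; exists (modulus c) => x; rewrite modulusM.
    by rewrite ler_wpM2l ?modulus_ge0.
  have [||||z1 z2 z3 z4] := @pair_step (w n./2) (fun x => c * f x).
  - exact: Ww.
  - exact: bcf.
  - by right=> y Yy; rewrite fY // mulr0.
  - by rewrite res_res // mulVf //; apply/eqP.
  exists (resx p n (w n./2), resf p n (fun x => c * f x)).
  split; [exact: z1|exact: z2|exact: z3|by left|] => /=.
  by exists 1; rewrite scale1r subrr; exact: sY.1.
have orth i j : i != j -> (p i).2 (p j).1 = 0.
  move=> ij; have [lt|gt|eq] := ltngtP i j; last by rewrite eq eqxx in ij.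
    by have [_ _ /(_ _ lt)[]] := hp j.
  by have [_ _ /(_ _ gt)[]] := hp i.
pose annY i := forall y, Y y -> (p i).2 y = 0.
pose Z := nclosure nu (lspan [set (p i).1 | i in annY]).
have sZ : linear_subspace Z.
  by apply: nclosure_subspace_subspace => //; exact: lspan_subspace.
have ZW : Z `<=` W.
  apply: subset_trans cW; apply: nclosureS; apply: lspan_min => //.
  by move=> _ [i _ <-]; have [[]] := hp i.
have bp i : bounded_functional (p i).2 by have [[]] := hp i.
exists Z; split=> //.
- exact: nclosure_idem.
- move=> z Zz Yz.
  (* Either the functional annihilates [Y], which contains [z], or its index is not among those
     generating [Z], and biorthogonality makes it vanish on [Z]. *)
  have pz i : (p i).2 z = 0.
    have [Yi|nYi] := pselect (annY i); first exact: Yi.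
    apply: (bounded_functional_kernel (bp i) _ Zz).
    apply: lspan_min.
      split; first by rewrite /= functional0 //; have [] := bp i.
      move=> a x y /= hx hy; have [l _] := bp i; rewrite l hx hy.
      by rewrite mulr0 addr0.
    move=> _ [j Yj <-] /=; apply: orth; apply: contra_notN nYi => /eqP->.
    exact: Yj.
  have gz k : g k z = 0.
    have [_ _ _ _] := hp k.*2.+1; rewrite /= odd_double /= uphalf_double.
    move=> [c /(_ z Yz (ZW _ Zz))]; rewrite pz mulr0 /resf.
    by rewrite big1 ?subr0 // => i _; rewrite pz mulr0.
  apply: nu_eq0; apply/eqP; rewrite eq_le seminorm_ge0 // andbT.
  apply/ler_addgt0Pl => e e0; rewrite addr0.
  have e2 : 0 < e / 2 by lra.
  (* A [w k] close to [z] is itself small, because [g k] norms it and vanishes at [z]. *)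
  have [_ [k _ <-] zw] := wd _ (ZW _ Zz) _ e2.
  have [lg gle gw] := hg k.
  have : nu (w k) <= nu (z - w k).
    rewrite seminorm_distC //; apply: le_trans (gle _).
    rewrite functionalB // gz subr0 gw modulus_of_real.
    by rewrite ger0_norm ?seminorm_ge0.
  have := snu.1 (z - w k) (w k); rewrite subrK; lra.
- move=> x /wd; apply: nclosureS => _ [k _ <-].
  have [_ _ _ _] := hp k.*2; rewrite odd_double doubleK => -[c Yc].
  have sYWZ : linear_subspace [set y + z | y in Y `&` W & z in Z].
    split; first by exists 0; [split; [exact: sY.1|exact: sW.1]|
      exists 0; [exact: sZ.1|rewrite addr0]].
    move=> a _ _ [y [Yy Wy] [z Zz <-]] [y' [Yy' Wy'] [z' Zz' <-]].
    exists (a *: y + y'); first by split; [exact: sY.2|exact: sW.2].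
    exists (a *: z + z'); first exact: sZ.2.
    by rewrite scalerDr addrACA.
  have up i : [set y + z | y in Y `&` W & z in Z] (p i).1.
    have [[Wi _] [Yi|Yi] _ _ _] := hp i.
      exists (p i).1; first by [].
      by exists 0; [exact: sZ.1|rewrite addr0].
    exists 0; first by split; [exact: sY.1|exact: sW.1].
    exists (p i).1; last by rewrite add0r.
    by apply: sub_nclosure => //; apply: sub_lspan; exists i.
  pose v := resx p k.*2 (w k) - c *: (p k.*2).1.
  have Wv : W v.
    apply: subspaceB => //; last first.
      by apply: subspaceZ => //; have [[]] := hp k.*2.
    apply: subspaceB => //; apply: subspace_sum => // i _.
    by apply: subspaceZ => //; have [[]] := hp i.
  have -> : w k = v + (c *: (p k.*2).1 +
      \sum_(i < k.*2) (p i).2 (w k) *: (p i).1).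
    by rewrite addrA /v subrK /resx subrK.
  apply: subspaceD => //.
    by exists v => //; exists 0; [exact: sZ.1|rewrite addr0].
  apply: subspaceD => //; first exact: subspaceZ.
  by apply: subspace_sum => // i _; exact: subspaceZ.
Qed.

End Mackey.

(** * Reflexive spaces: decompositions given by sets of pairs *)

Section Decomposition.
Variables (R : realType) (s : scalars).
Local Notation K := (scalar_field R s).
Variables (V D : lmodType K) (nu : V -> R) (mu : D -> R) (ev : D -> V -> K).
Hypothesis snu : seminorm nu.
Hypothesis nu_eq0 : forall x, nu x = 0 -> x = 0.
Hypothesis nu_complete : forall u : nat -> V,
  (forall e, 0 < e -> exists N, forall m n, (N <= m)%N -> (N <= n)%N ->
    nu (u m - u n) < e) ->
  exists l, forall e, 0 < e -> exists N, forall n, (N <= n)%N ->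
    nu (u n - l) < e.
Hypothesis smu : seminorm mu.
Hypothesis ev_functional : forall f, functional (ev f).
Hypothesis ev_functionall : forall x, functional (ev ^~ x).
Hypothesis ev_bound : forall f x, modulus (ev f x) <= mu f * nu x.
Hypothesis ev_surj : forall phi, bounded_functional nu phi ->
  exists f, ev f = phi.
Hypothesis ev_refl : forall Phi, functional Phi ->
  (forall f, modulus (Phi f) <= mu f) -> exists x, Phi = ev ^~ x.

(** The factor 2 replaces the attainment of the supremum of [f] on the unit ball of [W]: a vector
    reaching half of it is enough. *)
Lemma almost_norming_vector (W : set V) f : linear_subspace W ->
  exists w, [/\ W w, nu w <= 1 &
    forall x, W x -> modulus (ev f x) <= 2 * modulus (ev f w) * nu x].
Proof.
move=> sW; pose S := [set modulus (ev f x) | x in [set x | W x /\ nu x <= 1]].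
have Sub : ubound S (mu f).
  move=> _ [x /= [Wx nx] <-]; apply: (le_trans (ev_bound _ _)).
  by have := seminorm_ge0 f smu; nra.
have S0 : S 0.
  exists 0 => /=; last by rewrite functional0 // modulus0.
  by rewrite seminorm0 //; split; [exact: sW.1|lra].
have Sle x : W x -> modulus (ev f x) <= sup S * nu x.
  move=> Wx; have [x0|x0] := eqVneq (nu x) 0.
    by rewrite (nu_eq0 x0) functional0 // modulus0 seminorm0 // mulr0.
  have nx : 0 < nu x by rewrite lt_def x0 seminorm_ge0.
  rewrite -ler_pdivrMr //; apply: ub_le_sup; first by exists (mu f).
  exists (of_real s (nu x)^-1 *: x) => /=.
    split; first exact: subspaceZ.
    by rewrite snu.2 modulus_of_real gtr0_norm ?invr_gt0 // mulVf.
  by rewrite functionalZ // modulusM modulus_of_real gtr0_norm ?invr_gt0 // mulrC.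
have [m0|m0] := leP (sup S) 0.
  exists 0; split; [exact: sW.1|by rewrite seminorm0|].
  move=> x Wx; rewrite functional0 // modulus0 mulr0 mul0r.
  by apply: (le_trans (Sle _ Wx)); have := seminorm_ge0 x snu; nra.
have m2 : 0 < sup S / 2 by lra.
have [|_ [w /= [Ww nw] <-] mw] := sup_adherent (E := S) m2.
  by split; [exists 0|exists (mu f)].
exists w; split=> // x Wx; apply: (le_trans (Sle _ Wx)).
by have := seminorm_ge0 x snu; nra.
Qed.

Variable q : nat -> K.
Hypothesis q_dense : forall a e, 0 < e -> exists n, modulus (a - q n) < e.
Variable norming : V -> D.
Hypothesis normingE : forall x, ev (norming x) x = of_real s (nu x).
Hypothesis norming_le : forall x y, modulus (ev (norming x) y) <= nu y.

(* [a.1] and [a.2], for [a] in [M], play the roles of the elements of [V] and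
   of the dual lying in an elementary submodel. *)
Definition rational_pairs (M : set (V * D)) :=
  [/\ M 0, forall n a b, M a -> M b -> M (q n *: a + b) &
    forall a, M a -> exists2 b, M b & b.2 = norming a.1].

(** Dual to the last clause of [rational_pairs]: the functionals of [M], restricted to [W], are
    controlled by vectors of [M] lying in [W]. *)
Definition norming_pairs (W : set V) (M : set (V * D)) :=
  forall a, M a -> exists2 b, M b & [/\ W b.1, nu b.1 <= 1 &
    forall x, W x -> modulus (ev a.2 x) <= 2 * modulus (ev a.2 b.1) * nu x].

(** [prange] and [pker] are the future range and kernel of the projection attached to [M]. *)
Definition prange (M : set (V * D)) := nclosure nu [set a.1 | a in M].

Definition pker (M : set (V * D)) : set V :=
  [set x | forall a, M a -> ev a.2 x = 0].

Lemma prange_subspace M : rational_pairs M -> linear_subspace (prange M).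
Proof.
move=> [M0 Mq _]; apply: (nclosure_subspace _ q_dense) => //; first by exists 0.
move=> n _ _ [a Ma <-] [b Mb <-]; exists (q n *: a + b) => //.
exact: Mq.
Qed.

Lemma pker_subspace M : linear_subspace (pker M).
Proof.
split; first by move=> a _; rewrite functional0.
move=> c x y hx hy a Ma; rewrite ev_functional hx // hy //.
by rewrite mulr0 addr0.
Qed.

Lemma ev_bounded f : bounded_functional nu (ev f).
Proof. by split=> //; exists (mu f) => x; exact: ev_bound. Qed.

Lemma pker_closed M : nclosure nu (pker M) `<=` pker M.
Proof.
move=> x hx a Ma; apply: (bounded_functional_kernel snu (ev_bounded _) _ hx).
by move=> y /(_ _ Ma).
Qed.

(** For a first member of [M], its norming functional is a second member of [M], so it ignores [k].
    This makes the sum of range and kernel direct and its projection contractive. *)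
Lemma prange_pker_le M x k : rational_pairs M -> prange M x -> pker M k ->
  nu x <= nu (x + k).
Proof.
move=> [_ _ MJ] Mx Mk; apply/ler_addgt0Pl => e e0.
have e2 : 0 < e / 2 by lra.
have [_ [a Ma <-] xa] := Mx _ e2.
have [b Mb bE] := MJ _ Ma.
have h : nu a.1 <= nu (a.1 + k).
  apply: le_trans (norming_le a.1 _).
  rewrite functionalD // -bE (Mk _ Mb) addr0 bE normingE modulus_of_real.
  by rewrite ger0_norm ?seminorm_ge0.
have h1 := snu.1 (x - a.1) a.1; rewrite subrK in h1.
have h2 := seminormB (x + k) (x - a.1) snu.
have e1 : x + k - (x - a.1) = a.1 + k by rewrite opprB addrC addrA subrK.
rewrite e1 in h2; lra.
Qed.

Lemma prange_pker0 M x : rational_pairs M -> prange M x -> pker M x -> x = 0.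
Proof.
move=> rM Mx kx; apply: nu_eq0; apply/eqP; rewrite eq_le seminorm_ge0 // andbT.
have := prange_pker_le rM Mx (subspaceN (pker_subspace M) kx).
by rewrite subrr (seminorm0 snu).
Qed.

(** Since [e + k] controls [e], the first parts of a convergent sequence of sums form a Cauchy
    sequence, and completeness gives a limit to each part. *)
Lemma decomposition_closed M W : rational_pairs M -> linear_subspace W ->
  nclosure nu W `<=` W ->
  let G := [set e + k | e in nclosure nu ([set a.1 | a in M] `&` W) &
    k in pker M `&` W] in
  nclosure nu G `<=` G.
Proof.
move=> rM sW cW G x hx.
have hn n : exists ek : V * V,
   [/\ nclosure nu ([set a.1 | a in M] `&` W) ek.1, (pker M `&` W) ek.2 &
   nu (x - (ek.1 + ek.2)) < n.+1%:R^-1].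
  have [|_ [e he [k hk <-]] hek] := hx n.+1%:R^-1; first by rewrite invr_gt0.
  by exists (e, k).
have [ek hek] := choice hn; pose e n := (ek n).1; pose k n := (ek n).2.
have small c : 0 < c -> exists N, forall n, (N <= n)%N ->
    nu (x - (e n + k n)) < c.
  move=> c0; pose N := Num.truncn c^-1; exists N => n Nn; have [_ _ h] := hek n.
  apply: (lt_trans h); rewrite invf_plt ?posrE //.
  apply: (lt_le_trans (truncnS_gt _)).
  by rewrite ler_nat.
have rg n : prange M (e n).
  by have [h _ _] := hek n; move: h; apply: nclosureS => y [].
have [c c0|l hl] := nu_complete (u := e).
  have c2 : 0 < c / 2 by lra.
  have [N hN] := small _ c2; exists N => m n Nm Nn.
  have := @prange_pker_le M (e m - e n) (k m - k n) rM.
  have h1 := subspaceB (prange_subspace rM) (rg m) (rg n).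
  have h2 : pker M (k m - k n).
    have [_ [km _] _] := hek m; have [_ [kn _] _] := hek n.
    exact: (subspaceB (pker_subspace M) km kn).
  move=> /(_ h1 h2) h; apply: (le_lt_trans h).
  have -> : e m - e n + (k m - k n) =
      (x - (e n + k n)) - (x - (e m + k m)).
    by rewrite opprB [RHS]addrC [RHS]addrA subrK opprD addrACA.
  have := seminormB (x - (e n + k n)) (x - (e m + k m)) snu.
  by have := hN _ Nm; have := hN _ Nn; lra.
exists l.
  apply: (nclosure_idem snu) => c c0; have [N hN] := hl _ c0.
  exists (e N); first by have [] := hek N.
  by rewrite seminorm_distC // hN.
exists (x - l); last by rewrite addrC subrK.
suff : nclosure nu (pker M `&` W) (x - l).
  move=> h; split.
    by apply: pker_closed; move: h; apply: nclosureS => y [].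
  by apply: cW; move: h; apply: nclosureS => y [].
move=> c c0; have c2 : 0 < c / 2 by lra.
have [N hN] := small _ c2; have [N' hN'] := hl _ c2.
pose n := maxn N N'; exists (k n); first by have [] := hek n.
have -> : x - l - k n = (x - (e n + k n)) + (e n - l).
  by rewrite [e n + _]addrC opprD [RHS]addrA [x + (_ - _)]addrA subrK addrAC.
apply: (le_lt_trans (snu.1 _ _)).
have := hN n (leq_maxl _ _); have := hN' n (leq_maxr _ _); lra.
Qed.

(* The functional [f0] separating a point of [W] from the decomposable ones is,
   by reflexivity, a limit of sums of a second component of [M] and an
   annihilator of [W]; vectors of [M] norming the former show [f0 = 0] on
   [W]. *)
Lemma decomposition M W : rational_pairs M -> linear_subspace W ->
  nclosure nu W `<=` W -> norming_pairs W M ->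
  forall x, W x -> exists e k, [/\ prange M e, W e, pker M k, W k & x = e + k].
Proof.
move=> rM sW cW nM x Wx.
pose EW := nclosure nu ([set a.1 | a in M] `&` W).
pose G := [set e + k | e in EW & k in pker M `&` W].
have EWW : EW `<=` W.
  by apply: subset_trans cW; apply: nclosureS => y [].
have EWr : EW `<=` prange M by apply: nclosureS => y [].
suff [e he [k [hk Wk] <-]] : G x.
  by exists e, k; split=> //; [exact: EWr|exact: EWW].
have sEW : linear_subspace EW.
  have [M0 Mq _] := rM.
  apply: (nclosure_subspace _ q_dense) => //.
    by split; [exists 0|exact: sW.1].
  move=> n _ _ [[a Ma <-] Wa] [[b Mb <-] Wb]; split; last exact: sW.2.
  by exists (q n *: a + b) => //; exact: Mq.
have sG : linear_subspace G.
  split.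
    exists 0; first exact: sEW.1.
    exists 0; last by rewrite addr0.
    by split; [exact: (pker_subspace M).1|exact: sW.1].
  move=> a _ _ [e1 he1 [k1 [hk1 Wk1] <-]] [e2 he2 [k2 [hk2 Wk2] <-]].
  exists (a *: e1 + e2); first exact: sEW.2.
  exists (a *: k1 + k2); last by rewrite scalerDr addrACA.
  by split; [exact: (pker_subspace M).2|exact: sW.2].
apply: contrapT => Gx.
have [phi [lphi phile phiG phix]] :=
  hahn_banach_separation snu sG (fun h => Gx (decomposition_closed rM sW cW h)).
have [|f0 f0E] := ev_surj (phi := phi).
  by split=> //; exists 1 => y; rewrite mul1r.
pose C := [set b.2 + g | b in M & g in [set g | forall y, W y -> ev g y = 0]].
have C0 : C 0.
  have [M0 _ _] := rM; exists 0 => //; exists 0; last by rewrite addr0.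
  by move=> y _; rewrite (functional0 (ev_functionall y)).
have sC : linear_subspace (nclosure mu C).
  apply: (nclosure_subspace _ q_dense) => //.
  have [_ Mq _] := rM.
  move=> n _ _ [a Ma [f hf <-]] [b Mb [g hg <-]].
  exists (q n *: a + b); first exact: Mq.
  exists (q n *: f + g); last by rewrite scalerDr addrACA.
  by move=> y Wy; rewrite (ev_functionall y) hf // hg // mulr0 addr0.
(* Otherwise reflexivity yields a point [x'] killed by [C] but not by [f0]. Killed by the
   functionals of [M], it is in [pker M]; killed by the annihilator of [W], it is in [W]; so it
   belongs to [G], where [phi] vanishes. *)
have [Cf0|nCf0] := pselect (nclosure mu C f0); last first.
  have [||Phi [lPhi Phile PhiC]] :=
    @hahn_banach_separation _ _ _ _ smu (nclosure mu C) f0.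
  - exact: sC.
  - by move=> h; apply: nCf0; exact: nclosure_idem.
  have [x' x'E] := ev_refl lPhi Phile.
  have C_x' f : C f -> ev f x' = 0.
    by move=> Cf; have := PhiC f (sub_nclosure smu Cf); rewrite x'E.
  have kx' : pker M x'.
    move=> a Ma; apply: C_x'; exists a => //; exists 0; last by rewrite addr0.
    by move=> y _; rewrite (functional0 (ev_functionall y)).
  have Wx' : W x'.
    apply: contrapT => nW.
    have [g [lg gle gW gx']] :=
      hahn_banach_separation snu sW (fun h => nW (cW _ h)).
    have [|g' g'E] := ev_surj (phi := g).
      by split=> //; exists 1 => y; rewrite mul1r.
    apply: gx'; rewrite -g'E; apply: C_x'; have [M0 _ _] := rM.
    by exists 0 => //; exists g'; [rewrite /= g'E|rewrite add0r].
  rewrite x'E f0E; apply; apply: phiG; exists 0; first exact: sEW.1.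
  by exists x'; rewrite ?add0r.
apply: phix; apply: modulus_eq0; apply/eqP; rewrite eq_le modulus_ge0 andbT.
apply/ler_addgt0Pl => e e0; rewrite addr0.
have nx0 := seminorm_ge0 x snu.
have nx : 0 < 3 * (nu x + 1) by lra.
(* The error [h] contributes [d * nu x] to [phi x], and the functional of [M] at most twice that
   because of the factor in [norming_pairs]; hence the 3. *)
pose d := e / (3 * (nu x + 1)).
have d0 : 0 < d by exact: divr_gt0.
have dE : d * (3 * (nu x + 1)) = e by rewrite divfK // gt_eqF.
have [_ [a Ma [g gW <-]] hd] := Cf0 _ d0.
have [b Mb [Wb nb bn]] := nM _ Ma.
pose h := f0 - (a.2 + g).
have evE y : W y -> ev a.2 y = phi y - ev h y.
  move=> Wy; rewrite /h (functionalB _ _ (ev_functionall y)).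
  by rewrite (functionalD _ _ (ev_functionall y)) gW // f0E; ring.
have hle y : modulus (ev h y) <= d * nu y.
  apply: (le_trans (ev_bound _ _)).
  by rewrite ler_wpM2r ?seminorm_ge0 // ltW.
have phib : phi b.1 = 0.
  apply: phiG; exists b.1.
    by apply: sub_nclosure => //; split => //; exists b.
  exists 0; last by rewrite addr0.
  by split; [exact: (pker_subspace M).1|exact: sW.1].
have hb : modulus (ev a.2 b.1) <= d.
  rewrite evE // phib sub0r modulusN; apply: (le_trans (hle _)).
  by have := seminorm_ge0 b.1 snu; nra.
have -> : phi x = ev a.2 x + ev h x by rewrite evE // subrK.
apply: (le_trans (modulusD _ _)).
have h1 := bn _ Wx; have h2 := hle x.
have : modulus (ev a.2 b.1) * nu x <= d * nu x by rewrite ler_wpM2r.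
nra.
Qed.

(** * Projections preserving [Y] *)

Variable Y : set V.
Hypothesis sY : linear_subspace Y.
Hypothesis cY : nclosure nu Y `<=` Y.

Definition linear_op (Q : V -> V) :=
  forall a x y, Q (a *: x + y) = a *: Q x + Q y.

Lemma linear_op0 Q : linear_op Q -> Q 0 = 0.
Proof.
by move=> lQ; have := lQ (-1) 0 0; rewrite scaler0 addr0 scaleN1r addNr.
Qed.

Lemma linear_opD Q x y : linear_op Q -> Q (x + y) = Q x + Q y.
Proof. by move=> lQ; have := lQ 1 x y; rewrite !scale1r. Qed.

Lemma linear_opZ Q a x : linear_op Q -> Q (a *: x) = a *: Q x.
Proof. by move=> lQ; have := lQ a x 0; rewrite addr0 linear_op0 // addr0. Qed.

Lemma linear_opB Q x y : linear_op Q -> Q (x - y) = Q x - Q y.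
Proof.
by move=> lQ; rewrite linear_opD // -scaleN1r linear_opZ // scaleN1r.
Qed.

Definition bounded_op (Q : V -> V) :=
  linear_op Q /\ exists2 C, 0 < C & forall x, nu (Q x) <= C * nu x.

Lemma bounded_op_nclosure Q S x : bounded_op Q ->
  nclosure nu S x -> nclosure nu (Q @` S) (Q x).
Proof.
move=> [lQ [C C0 QC]] Sx e e0; have [y Sy xy] := Sx _ (divr_gt0 e0 C0).
exists (Q y); first by exists y.
rewrite -linear_opB //; apply: (le_lt_trans (QC _)).
by rewrite mulrC -ltr_pdivlMr.
Qed.

Lemma bounded_op_comp P Q : bounded_op P -> bounded_op Q ->
  bounded_op (P \o Q).
Proof.
move=> [lP [C C0 hP]] [lQ [C' C'0 hQ]]; split.
  by move=> a x y /=; rewrite lQ lP.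
exists (C * C'); first exact: mulr_gt0.
by move=> x /=; apply: (le_trans (hP _)); rewrite -mulrA ler_pM2l.
Qed.

Lemma bounded_opB P Q : bounded_op P -> bounded_op Q ->
  bounded_op (fun x => P x - Q x).
Proof.
move=> [lP [C C0 hP]] [lQ [C' C'0 hQ]]; split.
  by move=> a x y; rewrite lP lQ scalerBr addrACA opprD.
exists (C + C'); first exact: addr_gt0.
move=> x; apply: (le_trans (seminormB _ _ snu)); rewrite mulrDl.
exact: lerD.
Qed.

Lemma bounded_op0 : bounded_op (fun=> 0).
Proof.
split; first by move=> a x y; rewrite scaler0 addr0.
by exists 1 => // x; rewrite (seminorm0 snu) mul1r seminorm_ge0.
Qed.

Definition bounded_projection (Q : V -> V) :=
  [/\ bounded_op Q, forall x, Q (Q x) = Q x & forall y, Y y -> Y (Q y)].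

(** A single map for all operators, so that adjoints can appear among the Skolem functions. *)
Lemma adjoint_exists : exists adj : (V -> V) -> D -> D,
  forall Q, bounded_op Q -> forall f x, ev (adj Q f) x = ev f (Q x).
Proof.
have h (Qf : (V -> V) * D) : exists g, bounded_op Qf.1 ->
    forall x, ev g x = ev Qf.2 (Qf.1 x).
  have [[lQ [C C0 QC]]|nQ] := pselect (bounded_op Qf.1); last by exists 0.
  have [|g gE] := ev_surj (phi := fun x => ev Qf.2 (Qf.1 x)).
    split; first by move=> a x y; rewrite lQ ev_functional.
    exists (mu Qf.2 * C) => x; apply: (le_trans (ev_bound _ _)).
    by rewrite -mulrA ler_wpM2l ?seminorm_ge0.
  by exists g => _ x; rewrite gE.
have [adj hadj] := choice h.
by exists (fun Q f => adj (Q, f)) => Q bQ f x; exact: hadj (Q, f) bQ x.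
Qed.

(** Norming on the whole space decomposes every vector and so defines the projection; norming on [Y]
    decomposes the vectors of [Y] inside [Y], which makes [Y] invariant. *)
Definition submodel M :=
  [/\ rational_pairs M, norming_pairs setT M & norming_pairs Y M].

Definition proj M x := xget 0 [set e | prange M e /\ pker M (x - e)].

Lemma projP M x : submodel M ->
  prange M (proj M x) /\ pker M (x - proj M x).
Proof.
move=> [rM nM _]; rewrite /proj.
have sT : linear_subspace [set: V] by [].
have [//|e [k [re _ kk _ xE]]] := @decomposition M setT rM sT _ nM x I.
have := @xgetPex _ 0 [set e | prange M e /\ pker M (x - e)]; apply.
by exists e; split=> //; rewrite xE addrAC subrr add0r.
Qed.

Lemma proj_unique M x e : submodel M -> prange M e -> pker M (x - e) ->
  proj M x = e.
Proof.
move=> sM re ke; have [rM _ _] := sM; have [rp kp] := projP x sM.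
apply/eqP; rewrite -subr_eq0; apply/eqP.
apply: (prange_pker0 rM); first exact: (subspaceB (prange_subspace rM)).
have -> : proj M x - e = (x - e) - (x - proj M x).
  by rewrite opprB [RHS]addrC [RHS]addrA subrK.
exact: (subspaceB (pker_subspace M)).
Qed.

Lemma proj_id M x : submodel M -> prange M x -> proj M x = x.
Proof.
move=> sM rx; apply: proj_unique => //; rewrite subrr.
exact: (pker_subspace M).1.
Qed.

Lemma proj_proj M x : submodel M -> proj M (proj M x) = proj M x.
Proof. by move=> sM; apply: proj_id => //; have [] := projP x sM. Qed.

Lemma proj_linear M : submodel M -> linear_op (proj M).
Proof.
move=> sM a x y; have [rM _ _] := sM.
have [rx kx] := projP x sM; have [ry ky] := projP y sM.
apply: proj_unique => //; first exact: (prange_subspace rM).2.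
have -> : a *: x + y - (a *: proj M x + proj M y) =
    a *: (x - proj M x) + (y - proj M y).
  by rewrite scalerBr opprD addrACA.
exact: (pker_subspace M).2.
Qed.

Lemma proj_le M x : submodel M -> nu (proj M x) <= nu x.
Proof.
move=> sM; have [rM _ _] := sM; have [rx kx] := projP x sM.
by have := prange_pker_le rM rx kx; rewrite addrC subrK.
Qed.

Lemma proj_bounded M : submodel M -> bounded_op (proj M).
Proof.
move=> sM; split; first exact: proj_linear.
by exists 1 => // x; rewrite mul1r proj_le.
Qed.

Lemma proj_Y M y : submodel M -> Y y -> Y (proj M y).
Proof.
move=> sM Yy; have [rM _ nY] := sM.
have [e [k [re Ye kk _ yE]]] := decomposition rM sY cY nY Yy.
suff -> : proj M y = e by [].
by apply: proj_unique => //; rewrite yE addrAC subrr add0r.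
Qed.

(** Ranges increase and kernels decrease with the set of pairs. *)
Lemma proj_sub M N x : submodel M -> submodel N -> M `<=` N ->
  proj M (proj N x) = proj M x /\ proj N (proj M x) = proj M x.
Proof.
move=> sM sN MN.
have kNM z : pker N z -> pker M z by move=> h a /MN/h.
have [rx kx] := projP x sM; have [rNx kNx] := projP x sN.
have [rMNx kMNx] := projP (proj N x) sM.
split.
  apply/esym/proj_unique => //.
  have -> : x - proj M (proj N x) =
      (x - proj N x) + (proj N x - proj M (proj N x)) by rewrite addrA subrK.
  by apply: (subspaceD (pker_subspace M)) => //; exact: kNM.
apply: proj_id => //; move: rx; apply: nclosureS => _ [a Ma <-].
by exists a => //; exact: MN.
Qed.

(** Continuity of the projections along a union, tested on zeros. A vector [a.1] near [proj M z] is
    fixed by some [proj N], which is contractive and kills [proj M z]; so [a.1] is small. *)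
Lemma proj_limit0 M (C : set (set (V * D))) z : submodel M ->
  (forall N, C N -> submodel N) ->
  (forall a, M a -> exists2 N, C N & N a) ->
  (forall N, C N -> proj N z = 0) -> (forall N, C N -> N `<=` M) ->
  proj M z = 0.
Proof.
move=> sM sC CM Cz CsM; apply: nu_eq0; apply/eqP.
rewrite eq_le seminorm_ge0 // andbT; apply/ler_addgt0Pl => e e0; rewrite addr0.
have e2 : 0 < e / 2 by lra.
have [+ _] := projP z sM => /(_ _ e2)[_ [a Ma <-] za].
have [N CN Na] := CM _ Ma; have sN := sC _ CN.
have : nu a.1 <= nu (proj M z - a.1).
  apply: le_trans (proj_le _ sN).
  rewrite linear_opB; last exact: proj_linear.
  have [-> _] := proj_sub z sN sM (CsM _ CN).
  rewrite Cz // proj_id //; first by rewrite sub0r seminormN.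
  by apply: sub_nclosure => //; exists a.
have := snu.1 (proj M z - a.1) a.1; rewrite subrK; lra.
Qed.

(** Continuity along a union, tested on ranges: [proj M (Q x)] is a limit of vectors [Q a.1] with
    [a] in [M], and each of these equals [proj N (Q a.1)] for a member [N] of [C] containing [a]. *)
Lemma proj_limit_subspace M (C : set (set (V * D))) Q S :
  submodel M -> bounded_op Q -> (forall x, Q (Q x) = Q x) ->
  (forall x, Q (proj M x) = proj M (Q x)) ->
  (forall N, C N -> submodel N) ->
  (forall a, M a -> exists2 N, C N & N a) ->
  (forall N x, C N -> Q (proj N x) = proj N (Q x)) ->
  nclosure nu S `<=` S -> (forall N x, C N -> S (proj N (Q x))) ->
  forall x, S (proj M (Q x)).
Proof.
move=> sM bQ QQ QM sC CM QC cS CS x; apply: cS.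
have -> : proj M (Q x) = Q (proj M (Q x)) by rewrite QM QQ.
have [+ _] := projP (Q x) sM => /(bounded_op_nclosure bQ).
apply: nclosureS => _ [_ [a Ma <-] <-].
have [N CN Na] := CM _ Ma.
have <- : proj N (Q a.1) = Q a.1; last exact: CS.
rewrite -QC // proj_id //; first exact: sC.
by apply: sub_nclosure => //; exists a.
Qed.

Variable adj : (V -> V) -> D -> D.
Hypothesis adjE : forall Q, bounded_op Q -> forall f x,
  ev (adj Q f) x = ev f (Q x).

(** Stability of the first members under [Q] preserves the range, stability of the second ones under
    its adjoint preserves the kernel. *)
Lemma proj_commute M Q x : submodel M -> bounded_op Q ->
  (forall a, M a -> M (Q a.1, adj Q a.2)) ->
  Q (proj M x) = proj M (Q x).
Proof.
move=> sM bQ MQ; have [rx kx] := projP x sM; apply/esym/proj_unique => //.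
  move: (bounded_op_nclosure bQ rx); apply: nclosureS => _ [_ [a Ma <-] <-].
  by exists (Q a.1, adj Q a.2) => //; exact: MQ.
move=> a Ma; have [lQ _] := bQ; rewrite -linear_opB // -adjE //.
exact: (kx _ (MQ _ Ma)).
Qed.

Variables normT normY : D -> V.
Hypothesis normTE : forall f, nu (normT f) <= 1 /\
  forall x, modulus (ev f x) <= 2 * modulus (ev f (normT f)) * nu x.
Hypothesis normYE : forall f, [/\ Y (normY f), nu (normY f) <= 1 &
  forall x, Y x -> modulus (ev f x) <= 2 * modulus (ev f (normY f)) * nu x].

(** * Skolem hulls *)

Local Notation T := (V * D)%type.

(** All functions are binary, the unary ones ignoring an argument, so that a countable family is one
    sequence. *)
Inductive skolem_hull (F : nat -> T -> T -> T) (S : set T) : T -> Prop :=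
  | skolem_hull0 : skolem_hull F S 0
  | skolem_hull_base a : S a -> skolem_hull F S a
  | skolem_hull_op n a b : skolem_hull F S a -> skolem_hull F S b ->
      skolem_hull F S (F n a b).

(** The index is left open, so that a family keeps its properties when functions are added to it. *)
Definition has_op (F : nat -> T -> T -> T) (h : T -> T -> T) :=
  exists n, F n = h.

Definition op_of (Q : V -> V) (a b : T) : T := (Q a.1, adj Q a.2).

Definition base_ops F :=
  [/\ forall n, has_op F (fun a b => q n *: a + b),
    has_op F (fun a _ => (0, norming a.1)),
    has_op F (fun a _ => (normT a.2, 0)) &
    has_op F (fun a _ => (normY a.2, 0))].

Lemma skolem_hull_has_op F S h a b : has_op F h ->
  skolem_hull F S a -> skolem_hull F S b -> skolem_hull F S (h a b).
Proof. by move=> [n <-]; exact: skolem_hull_op. Qed.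

Lemma skolem_hull_submodel F S : base_ops F -> submodel (skolem_hull F S).
Proof.
move=> [Fq FJ FT FY]; split.
- split; first exact: skolem_hull0.
    by move=> n a b; exact: (skolem_hull_has_op (Fq n)).
  move=> a ha; exists (0, norming a.1) => //.
  exact: (skolem_hull_has_op FJ ha ha).
- move=> a ha; exists (normT a.2, 0); first exact: (skolem_hull_has_op FT ha ha).
  by have [h1 h2] := normTE a.2; split.
- move=> a ha; exists (normY a.2, 0); first exact: (skolem_hull_has_op FY ha ha).
  by have [h0 h1 h2] := normYE a.2; split.
Qed.

Lemma skolem_hullS F F' S S' : (forall h, has_op F h -> has_op F' h) ->
  S `<=` S' -> skolem_hull F S `<=` skolem_hull F' S'.
Proof.
move=> FF' SS' x; elim=> [|a Sa|n a b _ ha _ hb]; first exact: skolem_hull0.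
  exact/skolem_hull_base/SS'.
have [|k <-] := FF' (F n); first by exists n.
exact: skolem_hull_op.
Qed.

(** Elements of the hull are values of terms, and terms are finite trees labelled by integers. *)
Lemma skolem_hull_countable F S (u : nat -> T) : S `<=` range u ->
  exists w : nat -> T, skolem_hull F S `<=` range w.
Proof.
move=> Su.
pose eval := fix eval (t : GenTree.tree nat) : T := match t with
  | GenTree.Leaf i => u i
  | GenTree.Node n [:: t1; t2] => F n (eval t1) (eval t2)
  | _ => 0 end.
exists (fun n => if unpickle n is Some t then eval t else 0) => x.
suff : skolem_hull F S x -> exists t, eval t = x.
  by move=> /[apply] -[t <-]; exists (pickle t) => //; rewrite pickleK.
elim=> [|a /Su[i _ <-]|n a b _ [t1 <-] _ [t2 <-]].
(* A malformed term, to which [eval] gives the default value 0. *)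
- by exists (GenTree.Node 0 [::]).
- by exists (GenTree.Leaf i).
- by exists (GenTree.Node n [:: t1; t2]).
Qed.

(** [Z] is a quasicomplement, within [W], of the intersection of [Y] and [W]. *)
Definition quasicomplemented_in (W : set V) :=
  exists Z, [/\ linear_subspace Z, nclosure nu Z `<=` Z, Z `<=` W,
    forall x, Z x -> Y x -> x = 0 &
    forall x, W x -> nclosure nu [set y + z | y in Y `&` W & z in Z] x].

Definition gen (E : seq V) (I : set V) : set T :=
  [set a | (a.1 \in E \/ I a.1) /\ a.2 = 0].

(* The induction below is on initial segments [I] of a well-ordering of [V];
   quantifying over the finite set [E] and the countable family [F] absorbs
   successors, so that no cardinal arithmetic is needed. *)
Definition range_generated (I : set V) :=
  forall E F Q, base_ops F -> bounded_projection Q -> has_op F (op_of Q) ->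
    (forall x, Q x = x -> prange (skolem_hull F (gen E I)) x) ->
    quasicomplemented_in [set x | Q x = x].

Lemma fix_subspace Q : linear_op Q -> linear_subspace [set x | Q x = x].
Proof.
by move=> lQ; split=> [|a x y /= Qx Qy]; [exact: linear_op0|rewrite lQ Qx Qy].
Qed.

Lemma fix_closed Q : bounded_op Q ->
  nclosure nu [set x | Q x = x] `<=` [set x | Q x = x].
Proof.
move=> bQ x hx /=; apply/eqP; rewrite -subr_eq0; apply/eqP; apply: nu_eq0.
have [lQ [C C0 QC]] := bQ; apply/eqP.
rewrite eq_le seminorm_ge0 // andbT; apply/ler_addgt0Pl => e e0; rewrite addr0.
have C1 : 0 < C + 1 by lra.
have [y /= Qy xy] := hx _ (divr_gt0 e0 C1).
have -> : Q x - x = Q (x - y) - (x - y).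
  by rewrite linear_opB // Qy opprB addrA subrK.
apply: (le_trans (seminormB _ _ snu)); rewrite ltr_pdivlMr // in xy.
by have := QC (x - y); nra.
Qed.

(** The hull of a finite set is countable; its image under [Q] is dense in the range of [Q], which
    is thus separable. *)
Lemma range_generated_empty : range_generated set0.
Proof.
move=> E F Q bF [bQ QQ QY] FQ Qr.
have [lQ _] := bQ.
have [|w hw] := @skolem_hull_countable F (gen E set0) (fun i => (nth 0 E i, 0)).
  move=> [x f] [/= [xE|//] ->]; exists (index x E) => //.
  by rewrite nth_index.
apply: (separable_quasicomplement snu nu_eq0 sY cY (fix_subspace lQ)
  (fix_closed bQ) (w := fun n => Q (w n).1)) => [n /=|x /= Qx].
  by rewrite QQ.
have := bounded_op_nclosure bQ (Qr _ Qx); rewrite Qx.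
apply: nclosureS => _ [_ [a /hw[n _ <-] <-] <-].
by exists n.
Qed.

(** * Splitting a projection along a well-ordering *)

Variable prec : V -> V -> Prop.
Hypothesis prec_ind : forall P : V -> Prop,
  (forall d, (forall y, prec y d -> P y) -> P d) -> forall d, P d.
Hypothesis prec_trans : forall x y z, prec x y -> prec y z -> prec x z.
Hypothesis prec_total : forall x y, [\/ prec x y, x = y | prec y x].

Definition segment d : set V := [set x | prec x d].
Definition csegment d : set V := [set x | prec x d \/ x = d].

Lemma genS E I J : I `<=` J -> gen E I `<=` gen E J.
Proof.
by move=> IJ a [[h|h] a0]; split=> //; [left|right; exact: IJ].
Qed.

Lemma csegmentS y z : prec y z -> csegment y `<=` csegment z.
Proof. by move=> yz x [xy|->]; left=> //; exact: prec_trans yz. Qed.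

(** A term involves finitely many generators, and the largest of those taken from [I] bounds the
    others. So the hull is the union of a chain, as the limit lemmas require. *)
Lemma skolem_hull_cover F E I a : skolem_hull F (gen E I) a ->
  skolem_hull F (gen E set0) a \/
  exists2 y, I y & skolem_hull F (gen E (csegment y)) a.
Proof.
have mono I' J : I' `<=` J ->
    skolem_hull F (gen E I') `<=` skolem_hull F (gen E J).
  by move=> IJ; apply: skolem_hullS => //; exact: genS.
elim=> [|{}a [[h|h] a0]|n b c _ hb _ hc].
- by left; exact: skolem_hull0.
- by left; apply: skolem_hull_base; split=> //; left.
- by right; exists a.1 => //; apply: skolem_hull_base; split=> //; right; right.
case: hb => [hb|[y Iy hb]]; case: hc => [hc|[z Iz hc]].
- by left; exact: skolem_hull_op.
- by right; exists z => //; apply: skolem_hull_op => //; exact: (mono set0).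
- by right; exists y => //; apply: skolem_hull_op => //; exact: (mono set0).
- right; have [yz|eyz|zy] := prec_total y z.
  + exists z => //; apply: skolem_hull_op => //.
    exact: (mono _ _ (csegmentS yz)).
  + by exists z => //; apply: skolem_hull_op => //; rewrite -eyz.
  + exists y => //; apply: skolem_hull_op => //.
    exact: (mono _ _ (csegmentS zy)).
Qed.

Section Splitting.
Variables (E : seq V) (F : nat -> T -> T -> T) (Q : V -> V) (I : set V).
Hypothesis bF : base_ops F.
Hypothesis bQ : bounded_op Q.
Hypothesis QQ : forall x, Q (Q x) = Q x.
Hypothesis QY : forall y, Y y -> Y (Q y).
Hypothesis FQ : has_op F (op_of Q).
Hypothesis I_down : forall x y, prec x y -> I y -> I x.

Let hull J := skolem_hull F (gen E J).

Let hull_sub J : submodel (hull J).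
Proof. exact: skolem_hull_submodel. Qed.

Let hullS J J' : J `<=` J' -> hull J `<=` hull J'.
Proof. by move=> JJ'; apply: skolem_hullS => //; exact: genS. Qed.

(* The index [None] stands for the part generated by [E] alone. *)
Let lower (o : option V) x :=
  if o is Some d then proj (hull (segment d)) x else 0.
Let upper (o : option V) :=
  hull (if o is Some d then csegment d else set0).
Let idx (o : option V) := if o is Some d then I d else True.
Let before (o o' : option V) :=
  match o, o' with
  | None, Some _ => True
  | Some d, Some d' => prec d d'
  | _, None => False
  end.

Let upper_sub o : submodel (upper o).
Proof. exact: hull_sub. Qed.

#[local] Hint Resolve hull_sub upper_sub : core.

Let proj_lin J : linear_op (proj (hull J)).
Proof. exact: proj_linear. Qed.

Let Qproj J x : Q (proj (hull J) x) = proj (hull J) (Q x).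
Proof.
by apply: proj_commute => // a ha; exact: (skolem_hull_has_op FQ ha ha).
Qed.

(** The jump at [d] of the increasing projections, cut down to the range of [Q]; at [None], the
    initial projection. *)
Definition increment o x := proj (upper o) (Q x) - lower o (Q x).

Let upper_lower o x : proj (upper o) (lower o x) = lower o x.
Proof.
case: o => [d|] /=; last by rewrite linear_op0 //; exact: proj_lin.
have [] := @proj_sub (hull (segment d)) (hull (csegment d)) x => //.
by apply: hullS => y; left.
Qed.

Let lower_upper o x : lower o (proj (upper o) x) = lower o x.
Proof.
case: o => [d|] //=.
have [] := @proj_sub (hull (segment d)) (hull (csegment d)) x => //.
by apply: hullS => y; left.
Qed.

Let lower_lower o x : lower o (lower o x) = lower o x.
Proof. by case: o => [d|] //=; rewrite proj_proj. Qed.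

Let lower_bounded o : bounded_op (lower o).
Proof.
by case: o => [d|]; [exact: proj_bounded|exact: bounded_op0].
Qed.

Let lower_lin o : linear_op (lower o).
Proof. by have [] := lower_bounded o. Qed.

Let upper_lin o : linear_op (proj (upper o)).
Proof. exact: proj_lin. Qed.

Let upper_bounded o : bounded_op (proj (upper o)).
Proof. exact: proj_bounded. Qed.

Let Qlower o x : Q (lower o x) = lower o (Q x).
Proof. by case: o => [d|] /=; [exact: Qproj|rewrite linear_op0 //; case: bQ]. Qed.

Let incrementQ o x : Q (increment o x) = increment o x.
Proof.
have [lQ _] := bQ.
by rewrite /increment linear_opB // Qproj Qlower QQ.
Qed.

Lemma increment_bounded o : bounded_op (increment o).
Proof.
apply: (bounded_opB (P := proj (upper o) \o Q) (Q := lower o \o Q));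
  exact: bounded_op_comp.
Qed.

Lemma increment_idem o x : increment o (increment o x) = increment o x.
Proof.
rewrite {1}/increment incrementQ /increment.
rewrite (linear_opB _ _ (upper_lin o)) (linear_opB _ _ (lower_lin o)).
by rewrite upper_lower lower_upper lower_lower proj_proj // subrr subr0.
Qed.

Lemma increment_Y o y : Y y -> Y (increment o y).
Proof.
move=> Yy; apply: subspaceB => //; first by apply: proj_Y => //; exact: QY.
case: o => [d|] /=; last exact: sY.1.
by apply: proj_Y => //; exact: QY.
Qed.

Lemma increment_projection o : bounded_projection (increment o).
Proof.
split; [exact: increment_bounded|exact: increment_idem|exact: increment_Y].
Qed.

Let before_upper o o' x : before o o' ->
  [/\ proj (upper o) (proj (upper o') x) = proj (upper o) x,
    proj (upper o') (proj (upper o) x) = proj (upper o) x,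
    proj (upper o) (lower o' x) = proj (upper o) x &
    lower o' (proj (upper o) x) = proj (upper o) x].
Proof.
case: o' => [d|]; last by case: o.
have key J : J `<=` segment d ->
  [/\ proj (hull J) (proj (hull (csegment d)) x) = proj (hull J) x,
    proj (hull (csegment d)) (proj (hull J) x) = proj (hull J) x,
    proj (hull J) (proj (hull (segment d)) x) = proj (hull J) x &
    proj (hull (segment d)) (proj (hull J) x) = proj (hull J) x].
  move=> Jd.
  have Jcd : J `<=` csegment d by move=> y /Jd; left.
  have [-> ->] := proj_sub x (hull_sub J) (hull_sub (csegment d)) (hullS Jcd).
  by have [-> ->] := proj_sub x (hull_sub J) (hull_sub (segment d)) (hullS Jd).
case: o => [e /= ed|_]; last by apply: key => y.
apply: key => y [ye|-> //]; exact: (prec_trans ye).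
Qed.

Let upper_increment o x : proj (upper o) (increment o x) = increment o x.
Proof.
rewrite /increment linear_opB; last exact: proj_lin.
by rewrite proj_proj // upper_lower.
Qed.

Lemma increment_range o x : increment o x = x ->
  prange (skolem_hull F (gen E (if o is Some d then csegment d else set0))) x.
Proof.
move=> <-; have [h _] := projP (increment o x) (upper_sub o).
by move: h; rewrite upper_increment.
Qed.

(** Both projections of the later index fix the range of [upper o], and [proj (upper o)] absorbs
    both of them; so their difference cancels on either side. *)
Let increment_before o o' x : before o o' ->
  increment o (increment o' x) = 0 /\ increment o' (increment o x) = 0.
Proof.
move=> oo'; split; rewrite {1}/increment incrementQ.
  have h : proj (upper o) (increment o' x) = 0.
    rewrite /increment linear_opB; last exact: proj_lin.
    by have [-> _ _ _] := before_upper (Q x) oo'; have [_ _ -> _] :=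
      before_upper (Q x) oo'; rewrite subrr.
  by rewrite -[lower o _]lower_upper h sub0r linear_op0 ?oppr0 //;
    have [] := lower_bounded o.
rewrite -[in proj (upper o') _]upper_increment -[in lower o' _]upper_increment.
have [_ -> _ _] := before_upper (increment o x) oo'.
by have [_ _ _ ->] := before_upper (increment o x) oo'; rewrite subrr.
Qed.

Lemma increment_orth o o' x : o <> o' -> increment o (increment o' x) = 0.
Proof.
suff h : before o o' \/ before o' o -> increment o (increment o' x) = 0.
  move=> oo'; apply: h; case: o o' oo' => [d|] [d'|] //=.
  - move=> dd'; have [?|eq|?] := prec_total d d'; [by left| |by right].
    by case: dd'; rewrite eq.
  - by right.
  - by left.
by case=> /(increment_before x)[].
Qed.

Let cover (J : set V) : set (set T) :=
  [set N | N = upper None \/ exists2 y, J y & N = upper (Some y)].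

Let cover_hull J a : hull J a -> exists2 N, cover J N & N a.
Proof.
move=> /skolem_hull_cover[h|[y Jy h]].
  by exists (upper None) => //; left.
by exists (upper (Some y)) => //; right; exists y.
Qed.

Let cover_sub J N : cover J N -> submodel N.
Proof. by case=> [->|[y _ ->]]; exact: hull_sub. Qed.

Let cover_le J N : (forall x y, prec x y -> J y -> J x) ->
  cover J N -> N `<=` hull J.
Proof.
move=> Jd; case=> [->|[y Jy ->]]; apply: hullS => // x [|->//].
by move=> /Jd; exact.
Qed.

Let segment_down d x y : prec x y -> segment d y -> segment d x.
Proof. exact: prec_trans. Qed.

Let coverQ J N x : cover J N -> Q (proj N x) = proj N (Q x).
Proof. by case=> [->|[y _ ->]]; exact: Qproj. Qed.

(** Transfinite induction: a zero increment makes the projections at the closed and open segments of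
    [d] agree at [z], and the latter is a limit of earlier ones. *)
Lemma increments_eq0 z : Q z = z -> (forall o, idx o -> increment o z = 0) ->
  proj (hull I) z = 0.
Proof.
move=> Qz hz.
have hN : proj (upper None) z = 0.
  by have := hz None Logic.I; rewrite /increment Qz subr0.
have hI d : I d -> proj (upper (Some d)) z = 0.
  elim/prec_ind: d => d IH Id.
  have := hz (Some d) Id; rewrite /increment Qz => /eqP; rewrite subr_eq0 => /eqP.
  move=> ->; apply: (@proj_limit0 _ (cover (segment d))) => //.
  - exact: cover_sub.
  - exact: cover_hull.
  - move=> N [->//|[y yd ->]]; apply: IH => //; exact: I_down yd Id.
  - by move=> N; apply: cover_le; exact: segment_down.
apply: (@proj_limit0 _ (cover I)) => //.
- exact: cover_sub.
- exact: cover_hull.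
- by move=> N [->//|[y yd ->]]; exact: hI.
- by move=> N; exact: cover_le.
Qed.

(** The same induction for ranges: the projection at the closed segment is the increment plus a
    limit of earlier projections. *)
Lemma increments_span S : linear_subspace S -> nclosure nu S `<=` S ->
  (forall o x, idx o -> S (increment o x)) -> forall x, S (proj (hull I) (Q x)).
Proof.
move=> sS cS hS.
have hN x : S (proj (upper None) (Q x)).
  by have := hS None x Logic.I; rewrite /increment subr0.
have hI d x : I d -> S (proj (upper (Some d)) (Q x)).
  elim/prec_ind: d x => d IH x Id.
  have -> : proj (upper (Some d)) (Q x) =
      increment (Some d) x + lower (Some d) (Q x) by rewrite /increment subrK.
  apply: (subspaceD sS); first exact: hS.
  apply: (@proj_limit_subspace (hull (segment d)) (cover (segment d)) Q S) => //.
  - exact: cover_sub.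
  - exact: cover_hull.
  - by move=> N y; exact: coverQ.
  - by move=> N y [->//|[z zd ->]]; apply: IH => //; exact: I_down zd Id.
apply: (@proj_limit_subspace (hull I) (cover I) Q S) => //.
- exact: cover_sub.
- exact: cover_hull.
- by move=> N y; exact: coverQ.
- by move=> N y [->//|[z zd ->]]; exact: hI.
Qed.

Hypothesis Q_range : forall x, Q x = x -> prange (hull I) x.
Hypothesis pieces : forall o, idx o ->
  quasicomplemented_in [set x | increment o x = x].

(** By orthogonality [increment o] maps the closed span of all pieces into [Z o], and it preserves
    [Y]. A common vector of [Y] and this span thus has all its increments zero, and vanishes. *)
Lemma quasicomplement_of_pieces : quasicomplemented_in [set x | Q x = x].
Proof.
have hZ o : exists Z, idx o -> [/\ linear_subspace Z, nclosure nu Z `<=` Z,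
    Z `<=` [set x | increment o x = x], forall x, Z x -> Y x -> x = 0 &
    forall x, increment o x = x -> nclosure nu
      [set y + z | y in Y `&` [set x | increment o x = x] & z in Z] x].
  have [/pieces[Z hZ]|no] := pselect (idx o); last by exists set0.
  by exists Z.
have [Z {}hZ] := choice hZ.
pose U := lspan [set x | exists2 o, idx o & Z o x].
pose W := [set x | Q x = x].
have sW : linear_subspace W by apply: fix_subspace; case: bQ.
have cW : nclosure nu W `<=` W by exact: fix_closed.
have fixW o x : increment o x = x -> W x.
  by rewrite /W /= => <-; rewrite incrementQ.
have UW : nclosure nu U `<=` W.
  apply: subset_trans cW; apply: nclosureS; apply: lspan_min => // x [j ij Zx].
  have [_ _ ZR _ _] := hZ _ ij.
  exact: (fixW j _ (ZR _ Zx)).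
have QI x : W x -> proj (hull I) x = x.
  by move=> Wx; apply: proj_id => //; exact: Q_range.
have sU : linear_subspace (nclosure nu U).
  by apply: nclosure_subspace_subspace => //; exact: lspan_subspace.
exists (nclosure nu U); split=> //; first exact: nclosure_idem.
  move=> z Uz Yz; rewrite -(QI z (UW _ Uz)).
  apply: increments_eq0; first exact: UW.
  move=> o io; have [sZ cZ ZR ZY _] := hZ _ io.
  apply: ZY; last exact: increment_Y.
  apply: cZ; have := bounded_op_nclosure (increment_bounded o) Uz.
  have [lR _] := increment_bounded o.
  apply: nclosureS => _ [x Ux <-]; move: x Ux.
  apply: lspan_min.
    split; first by rewrite /= linear_op0 //; exact: sZ.1.
    by move=> a x y /= Zx Zy; rewrite lR; exact: sZ.2.
  move=> x [j ij Zx] /=; have [_ _ ZR' _ _] := hZ _ ij.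
  have [oj|oj] := pselect (o = j).
    by rewrite oj ZR'.
  by rewrite -(ZR' _ Zx) increment_orth //; exact: sZ.1.
move=> x Wx; have xE : proj (hull I) (Q x) = x by rewrite Wx QI.
pose S := [set y + z | y in Y `&` W & z in nclosure nu U].
have sS : linear_subspace S.
  split.
    exists 0; first by split; [exact: sY.1|exact: sW.1].
    by exists 0; [exact: sU.1|rewrite addr0].
  move=> a _ _ [y [Yy Wy] [z Zz <-]] [y' [Yy' Wy'] [z' Zz' <-]].
  exists (a *: y + y'); first by split; [exact: sY.2|exact: sW.2].
  exists (a *: z + z'); first exact: sU.2.
  by rewrite scalerDr addrACA.
rewrite -[x in nclosure _ _ x]xE.
apply: increments_span.
- exact: nclosure_subspace_subspace.
- exact: nclosure_idem.
- move=> o v io; have [_ _ _ _ dZ] := hZ _ io.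
  move: (dZ _ (increment_idem o v)); apply: nclosureS.
  move=> _ [y [Yy /= Ry] [z Zz <-]].
  exists y; first by split=> //; exact: (fixW o).
  exists z => //; apply: sub_nclosure => //; apply: sub_lspan.
  by exists o.
Qed.

End Splitting.

(** The range of the increment at [d] is generated by the closed segment of [d]. Moving [d] to the
    finite list leaves the open segment, and adding the increment to the family makes the new hulls
    stable under it and its adjoint. *)
Lemma range_generated_step I :
  (forall x y, prec x y -> I y -> I x) ->
  (forall d, I d -> range_generated (segment d)) -> range_generated I.
Proof.
move=> I_down IH E F Q bF [bQ QQ QY] FQ Qr.
apply: (@quasicomplement_of_pieces E F Q I) => // o io.
pose Ro := increment E F Q o.
(* The increment takes index 0 and the old functions move up by one. *)
pose F' n := if n is m.+1 then F m else op_of Ro.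
have FF' h : has_op F h -> has_op F' h by move=> [n <-]; exists n.+1.
have bF' : base_ops F'.
  have [h1 h2 h3 h4] := bF; split; [move=> n|..]; exact: FF'.
have pR : bounded_projection Ro by exact: increment_projection.
have FR : has_op F' (op_of Ro) by exists 0%N.
have key J E' : (forall x, Ro x = x -> prange (skolem_hull F (gen E J)) x) ->
    gen E J `<=` gen E' (if o is Some d then segment d else set0) ->
    forall x, Ro x = x -> prange (skolem_hull F'
      (gen E' (if o is Some d then segment d else set0))) x.
  move=> h EE' x Rx; move: (h _ Rx); apply: nclosureS => _ [a ha <-].
  by exists a => //; move: a ha; exact: skolem_hullS.
have ur x : Ro x = x ->
    prange (skolem_hull F (gen E (if o is Some d then csegment d else set0))) x.
  by move=> Rx; apply: (increment_range (Q := Q)).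
case: o io @Ro @F' FF' bF' pR FR key ur => [d|] io Ro F' FF' bF' pR FR key ur.
  apply: (IH d io (d :: E) F') => //; apply: key ur _.
  move=> a [[h|[h|h]] a0]; split=> //.
  - by left; rewrite inE h orbT.
  - by right.
  - by left; rewrite h mem_head.
by apply: (range_generated_empty (E := E) bF') => //; apply: key ur _.
Qed.

Lemma range_generated_setT : range_generated setT.
Proof.
apply: range_generated_step => // d _; elim/prec_ind: d => d IH.
by apply: range_generated_step => [x y|y /IH//]; exact: prec_trans.
Qed.

Lemma reflexive_quasicomplement : quasicomplemented_in setT.
Proof.
pose ops n : T -> T -> T := match n with
  | 0 => fun a _ => (0, norming a.1)
  | 1 => fun a _ => (normT a.2, 0)
  | 2 => fun a _ => (normY a.2, 0)
  | 3 => op_of id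
  | n.+4 => fun a b => q n *: a + b
  end.
have bops : base_ops ops.
  split; [move=> n; by exists n.+4|by exists 0%N|by exists 1%N|by exists 2%N].
have pid : bounded_projection id.
  by split=> //; split=> //; exists 1 => // x; rewrite mul1r.
have [|x _|Z hZ] := @range_generated_setT [::] ops id bops pid.
- by exists 3%N.
- apply: sub_nclosure => //; exists (x, 0) => //.
  by apply: skolem_hull_base; split=> //; right.
- exists Z; move: hZ.
  by have -> : [set x : V | id x = x] = setT by apply/seteqP; split.
Qed.

End Decomposition.

(** * Hamel bases and finite spans *)

Section HamelBases.
Variables (R : realType) (s : scalars).
Local Notation K := (scalar_field R s).
Variable V : lmodType K.
Implicit Types (B S : set V) (t : seq V).

Let uniq_span B x := exists t (a : V -> K),
  [/\ uniq t, [set` t] `<=` B & x = \sum_(v <- t) a v *: v].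

Let uniq_spanD1 B x v (c : K) : uniq_span B x -> B v -> uniq_span B (x + c *: v).
Proof.
move=> [t [a [ut tB ->]]] Bv; have [vt|vt] := boolP (v \in t).
  exists t, (fun w => a w + if w == v then c else 0); split=> //.
  under [RHS]eq_bigr do rewrite scalerDl.
  rewrite big_split /=; congr (_ + _).
  rewrite (bigD1_seq v) //= eqxx big1 ?addr0 // => w /negbTE->.
  by rewrite scale0r.
exists (v :: t), (fun w => if w == v then c else a w); split => //=.
- by rewrite vt.
- by move=> w; rewrite /= inE => /orP[/eqP->//|/tB].
rewrite big_cons eqxx addrC; congr (_ + _).
rewrite big_seq [RHS]big_seq; apply: eq_bigr => w wt.
by case: eqP => // wv; rewrite -wv wt in vt.
Qed.

Let uniq_span_sum B x t (a : V -> K) : uniq_span B x -> [set` t] `<=` B ->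
  uniq_span B (x + \sum_(v <- t) a v *: v).
Proof.
elim: t x => [|v t IH] x hx tB; first by rewrite big_nil addr0.
rewrite big_cons addrA; apply: IH.
  by apply: uniq_spanD1 => //; apply: tB; rewrite /= mem_head.
by move=> w /= wt; apply: tB; rewrite /= inE wt orbT.
Qed.

(** Lists in [linear_span] may repeat vectors; merging the repetitions gives the duplicate-free form
    on which linear independence acts. *)
Lemma linear_span_uniq B x : linear_span B x -> exists t (a : V -> K),
  [/\ uniq t, [set` t] `<=` B & x = \sum_(v <- t) a v *: v].
Proof.
move=> [t [a [tB ->]]]; rewrite -[X in exists t a, [/\ _, _ & X = _]]add0r.
apply: uniq_span_sum => //; exists [::], (fun=> 0); split=> //.
by rewrite big_nil.
Qed.

Lemma linear_span_subspace B : linear_subspace (linear_span B).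
Proof.
split; first by exists [::], (fun=> 0); rewrite big_nil; split.
move=> c x y [t [a [tB ->]]] [t' [a' [tB' ->]]].
have : uniq_span B
    (\sum_(v <- t) (c * a v) *: v + \sum_(v <- t') a' v *: v).
  apply: uniq_span_sum => //; rewrite -[X in uniq_span _ X]add0r.
  apply: uniq_span_sum => //; exists [::], (fun=> 0); split=> //.
  by rewrite big_nil.
move=> [t2 [a2 [_ t2B e]]]; exists t2, a2; split=> //; rewrite -e; congr (_ + _).
by rewrite scaler_sumr; apply: eq_bigr => v _; rewrite scalerA.
Qed.

Lemma sub_linear_span B : B `<=` linear_span B.
Proof.
move=> v Bv; exists [:: v], (fun=> 1); split; last by rewrite big_seq1 scale1r.
by move=> w; rewrite /= inE => /eqP->.
Qed.

Lemma linear_span_min B S : linear_subspace S -> B `<=` S ->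
  linear_span B `<=` S.
Proof.
move=> sS BS _ [t [a [tB ->]]]; apply: subspace_sum => // v vt.
by apply: subspaceZ => //; exact/BS/tB.
Qed.

Lemma linearly_independentU1 B x : linearly_independent B ->
  ~ linear_span B x -> linearly_independent (x |` B).
Proof.
move=> iB nx t a ut tB t0.
have key : x \in t -> a x = 0.
  move=> xt; apply/eqP/negPn/negP => ax; apply: nx.
  have : linear_span B (\sum_(v <- rem x t) (- (a x)^-1 * a v) *: v).
    apply: subspace_sum; first exact: linear_span_subspace.
    move=> v; rewrite mem_rem_uniq // inE => /andP[/eqP vx vt].
    apply: subspaceZ; first exact: linear_span_subspace.
    by apply: sub_linear_span; have [/vx|] := tB v vt.
  congr (linear_span B _).
  move: t0; rewrite (big_rem x) //= => /eqP; rewrite addrC addr_eq0 => /eqP e.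
  under eq_bigr do rewrite -scalerA.
  by rewrite -scaler_sumr e scalerN scaleNr opprK scalerA mulVf // scale1r.
have [xt|xt] := boolP (x \in t); last first.
  apply: iB => // v vt; have [vx|//] := tB v vt.
  by rewrite /= in vt; rewrite -vx vt in xt.
have iBr := iB (rem x t) a (rem_uniq _ ut).
move: t0; rewrite (big_rem x) //= key // scale0r add0r => /iBr{}iBr v vt.
have [->|vx] := eqVneq v x; first exact: key.
apply: iBr; last by rewrite mem_rem_uniq // inE vx.
move=> w /=; rewrite mem_rem_uniq // inE => /andP[/eqP wx wt].
by have [/wx|] := tB w wt.
Qed.

Lemma hamel_basis_exists S : linear_subspace S -> exists B, hamel_basis S B.
Proof.
move=> sS; pose P B := B `<=` S /\ linearly_independent B.
have [C PC Ctot|B [[BS iB] Bmax]] := @Zorn_bigcup V P.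
  split; first by move=> x [X CX Xx]; have [XS _] := PC X CX; exact: XS.
  move=> t a ut tC t0.
  have [t_nil|[X CX tX]] : t = [::] \/ exists2 X, C X & [set` t] `<=` X.
  - elim: {a ut t0} t tC => [|v t IH] tC; first by left.
    right; have [X CX Xv] := tC v (mem_head v t).
    have [|t_nil|[X' CX' tX']] := IH.
    + by move=> w /= wt; apply: tC; rewrite /= inE wt orbT.
    + by exists X => // w; rewrite t_nil /= inE => /eqP->.
    + have [XX'|X'X] := Ctot X X' CX CX'.
        by exists X' => // w; rewrite /= inE => /orP[/eqP->|/tX' //]; exact: XX'.
      by exists X => // w; rewrite /= inE => /orP[/eqP->//|/tX']; exact: X'X.
  - by rewrite t_nil.
  - by have [_ iX] := PC X CX; exact: iX.
exists B; split=> //; apply/seteqP; split; first exact: linear_span_min.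
move=> x Sx; apply: contrapT => nx; apply: (Bmax (x |` B)).
  split; last by move=> h; apply: nx; apply: sub_linear_span; apply: h; left.
  by move=> y By; right.
split; last exact: linearly_independentU1.
by move=> y [->//|/BS].
Qed.

(** If [t] were longer, the matrix of its coefficients over [t'] would have more rows than columns,
    and a nonzero row vector killing it would be a linear relation in [t]. *)
Lemma independent_size_le t t' : uniq t -> linearly_independent [set` t] ->
  [set` t] `<=` linear_span [set` t'] -> (size t <= size t')%N.
Proof.
move=> ut it tt'; rewrite leqNgt; apply/negP => lt.
have hrow (i : 'I_(size t)) : exists a : 'I_(size t') -> K,
    t`_i = \sum_(j < size t') a j *: t'`_j.
  have : linear_span [set` t'] t`_i by apply: tt'; exact: mem_nth.
  move: t`_i => x; apply: (@linear_span_min _ [set x | exists a : 'I__ -> K,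
    x = \sum_(j < size t') a j *: t'`_j]).
    split; first by exists (fun=> 0); rewrite big1 // => j _; rewrite scale0r.
    move=> c _ _ [a ->] [b ->]; exists (fun j => c * a j + b j).
    rewrite scaler_sumr -big_split /=; apply: eq_bigr => j _.
    by rewrite scalerDl scalerA.
  move=> v vt'; have jlt : (index v t' < size t')%N by rewrite index_mem.
  exists (fun j => if j == Ordinal jlt then 1 else 0).
  rewrite (bigD1 (Ordinal jlt)) //= eqxx scale1r nth_index // big1 ?addr0 //.
  by move=> j /negbTE->; rewrite scale0r.
have [a ha] := choice hrow.
pose M : 'M[K]_(size t, size t') := \matrix_(i, j) a i j.
have : ~~ row_free M.
  by rewrite /row_free neq_ltn (leq_ltn_trans (rank_leq_col M)).
rewrite -kermx_eq0 => /rowV0Pn[u uM u0].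
have uM0 : u *m M = 0 by apply/eqP; rewrite -sub_kermx.
have : \sum_(v <- t) (if insub (index v t) is Some i then u 0 i else 0) *: v = 0.
  rewrite (big_nth 0) big_mkord.
  transitivity (\sum_(i < size t) u 0 i *: t`_i).
    apply: eq_bigr => i _; rewrite index_uniq //.
    by case: insubP => [j _ /val_inj->//|]; rewrite ltn_ord.
  under eq_bigr do rewrite ha scaler_sumr.
  rewrite exchange_big /= big1 // => j _.
  transitivity ((u *m M) 0 j *: t'`_j); last by rewrite uM0 mxE scale0r.
  rewrite mxE scaler_suml; apply: eq_bigr => i _.
  by rewrite mxE scalerA.
move=> /(it _ _ ut (@subset_refl _ _)) h; move/negP: u0; apply.
apply/eqP/rowP => i; rewrite mxE.
have := h t`_i (mem_nth _ (ltn_ord i)); rewrite index_uniq //.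
by case: insubP => [j _ /val_inj->//|]; rewrite ltn_ord.
Qed.

Lemma infinite_dimensional_not_span S t : infinite_dimensional S ->
  ~ S `<=` linear_span [set` t].
Proof.
move=> [B [iB BS] infB] St.
have [C CB sC] := infinite_set_fset (size t).+1 infB.
suff : (size (finmap.enum_fset C) <= size t)%N by rewrite leqNgt sC.
apply: independent_size_le.
- exact: finmap.fset_uniq.
- by move=> u a uu uC; apply: iB => //; apply: subset_trans CB.
- move=> x xC; apply: St; rewrite -BS; apply: sub_linear_span; exact: CB.
Qed.

Lemma infinite_dimensional_of_not_span S : linear_subspace S ->
  (forall t, [set` t] `<=` S -> ~ S `<=` linear_span [set` t]) ->
  infinite_dimensional S.
Proof.
move=> sS h; have [B hB] := hamel_basis_exists sS; exists B => //.
have [iB BS] := hB; move=> /finite_seqP[t Bt]; apply: (h t); rewrite -Bt -BS //.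
exact: sub_linear_span.
Qed.

End HamelBases.

(** * Topology and dual of a normed space through the real-valued norm *)

Section RealNorm.
Variables (R : realType) (s : scalars).
Local Notation K := (scalar_field R s).
Variable X : normedModType K.

Definition rnorm (x : X) : R := real_part `|x|.

Lemma rnormE x : of_real s (rnorm x) = `|x|.
Proof. exact: real_partK. Qed.

Lemma rnorm_seminorm : seminorm rnorm.
Proof.
split=> [x y|a x].
  by rewrite -(of_real_le s) of_realD !rnormE ler_normD.
by apply: (@of_real_inj _ s); rewrite of_realM modulusE !rnormE normrZ.
Qed.

Lemma rnorm_eq0 x : rnorm x = 0 -> x = 0.
Proof. by move=> h; apply: normr0_eq0; rewrite -rnormE h of_real0. Qed.

Lemma nbhs_rnormP (x : X) (A : set X) :
  nbhs x A <-> exists2 e, 0 < e & forall y, rnorm (x - y) < e -> A y.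
Proof.
rewrite -nbhs_ballE; split=> [[e /= e0 eA]|[e e0 eA]].
  exists (real_part e); first by rewrite -(of_real_lt s) of_real0 real_partK ?ltW.
  move=> y xy; apply: eA; rewrite -ball_normE /=.
  by rewrite -rnormE -(real_partK (ltW e0)) of_real_lt.
exists (of_real s e); first by rewrite /= -(of_real0 R s) of_real_lt.
move=> y; rewrite -ball_normE /= -rnormE of_real_lt; exact: eA.
Qed.

Lemma closure_nclosure (A : set X) : closure A = nclosure rnorm A.
Proof.
apply/seteqP; split=> x.
  move=> h e e0; have [|y [Ay xy]] := h [set y | rnorm (x - y) < e].
    by apply/nbhs_rnormP; exists e.
  by exists y.
move=> h B /nbhs_rnormP[e e0 eB]; have [y Ay xy] := h e e0.
by exists y; split=> //; exact: eB.
Qed.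

Lemma dense_nclosure (A : set X) : dense A <-> forall x, nclosure rnorm A x.
Proof.
rewrite -closure_nclosure; split=> [dA x B|h O [x Ox] oO].
  rewrite nbhsE => -[U [oU Ux] UB].
  have [|y [Uy Ay]] := dA U _ oU; first by exists x.
  by exists y; split=> //; exact: UB.
have [|y [Ay Oy]] := h x O; first exact: open_nbhs_nbhs.
by exists y.
Qed.

Lemma bounded_functional_continuous (f : X -> K^o) :
  bounded_functional rnorm f -> continuous f.
Proof.
move=> [lf [M hM]] x; apply/cvgrPdist_lt => e e0.
have re0 : 0 < real_part e by rewrite -(of_real_lt s) of_real0 real_partK ?ltW.
have M1 : 0 < `|M| + 1 by have := normr_ge0 M; lra.
apply/nbhs_rnormP; exists (real_part e / (`|M| + 1)); first exact: divr_gt0.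
move=> y; rewrite ltr_pdivlMr // => xy.
rewrite -(functionalB _ _ lf) -modulusE -(real_partK (ltW e0)) of_real_lt.
apply: (le_lt_trans (hM _)).
have := ler_norm M; have := seminorm_ge0 (x - y) rnorm_seminorm; nra.
Qed.

Lemma continuous_bounded_functional (f : X -> K^o) :
  functional f -> continuous f -> bounded_functional rnorm f.
Proof.
move=> lf cf; split=> //.
have := cf 0 => /cvgrPdist_lt /(_ 1 ltr01) /nbhs_rnormP[e e0 he].
exists (2 / e) => x.
have [x0|x0] := eqVneq (rnorm x) 0.
  rewrite (rnorm_eq0 x0) functional0 // modulus0.
  by rewrite (seminorm0 rnorm_seminorm) mulr0.
have nx : 0 < rnorm x by rewrite lt_def x0 (seminorm_ge0 _ rnorm_seminorm).
(* Brings [x] to norm [e / 2], inside the ball on which [f] has modulus below 1; hence the bound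
   [2 / e]. *)
pose c := e / 2 / rnorm x.
have c0 : 0 < c by rewrite !divr_gt0.
have := he (of_real s c *: x).
rewrite sub0r (seminormN _ rnorm_seminorm) rnorm_seminorm.2 modulus_of_real.
rewrite gtr0_norm // /c divfK // => /(_ ltac:(lra)).
rewrite (functional0 lf) sub0r normrN functionalZ // -modulusE modulusM.
rewrite -(of_real1 R s) of_real_lt modulus_of_real gtr0_norm // => h.
have cE : c * (2 / e * rnorm x) = 1.
  by rewrite /c; field; rewrite x0 gt_eqF.
rewrite -(ler_pM2l c0) cE; exact: ltW.
Qed.

Lemma dual_bounded (f : dual X) : bounded_functional rnorm f.
Proof.
by have /asboolP[lf cf] := valP f; exact: continuous_bounded_functional.
Qed.

Lemma dual_of_bounded (f : X -> K^o) : bounded_functional rnorm f ->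
  exists g : dual X, (g : X -> K) = f.
Proof.
move=> bf; have fd : f \in dual_pred (X := X).
  apply/asboolP; split; last exact: bounded_functional_continuous.
  by move=> a x y; case: bf => lf _; rewrite lf.
by exists (Dual fd).
Qed.

(** The operator norm as the least bound, to match the bounds quantified over in the definition of
    the bidual. *)
Definition dual_rnorm (f : dual X) : R :=
  inf [set c | 0 <= c /\ forall x, modulus (f x) <= c * rnorm x].

Lemma dual_rnorm_le (f : dual X) c : 0 <= c ->
  (forall x, modulus (f x) <= c * rnorm x) -> dual_rnorm f <= c.
Proof. by move=> c0 h; apply: ge_inf; [exists 0 => d [] //|]. Qed.

Lemma dual_rnorm_ge (f : dual X) c :
  (forall d, 0 <= d -> (forall x, modulus (f x) <= d * rnorm x) -> c <= d) ->
  c <= dual_rnorm f.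
Proof.
move=> h; apply: lb_le_inf; last by move=> d [d0 hd]; exact: h.
have [_ [M hM]] := dual_bounded f; exists `|M|; split=> // x.
apply: (le_trans (hM x)); apply: ler_wpM2r; last exact: ler_norm.
exact: seminorm_ge0 rnorm_seminorm.
Qed.

Lemma dual_bound (f : dual X) x : modulus (f x) <= dual_rnorm f * rnorm x.
Proof.
have [x0|x0] := eqVneq (rnorm x) 0.
  have [_ [M hM]] := dual_bounded f.
  by have := hM x; rewrite x0 !mulr0.
have nx : 0 < rnorm x by rewrite lt_def x0 (seminorm_ge0 _ rnorm_seminorm).
rewrite -ler_pdivrMr //; apply: dual_rnorm_ge => d d0 hd.
by rewrite ler_pdivrMr.
Qed.

Lemma dual_rnorm_ge0 (f : dual X) : 0 <= dual_rnorm f.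
Proof. exact: dual_rnorm_ge. Qed.

Lemma dual_rnorm_seminorm : seminorm dual_rnorm.
Proof.
have key a (f : dual X) : dual_rnorm (a *: f) <= modulus a * dual_rnorm f.
  apply: dual_rnorm_le; first by rewrite mulr_ge0 ?modulus_ge0 ?dual_rnorm_ge0.
  move=> x; rewrite modulusM -mulrA ler_wpM2l ?modulus_ge0 //.
  exact: dual_bound.
split=> [f g|a f].
  apply: dual_rnorm_le; first by rewrite addr_ge0 ?dual_rnorm_ge0.
  move=> x; apply: (le_trans (modulusD _ _)).
  by rewrite mulrDl lerD ?dual_bound.
apply/eqP; rewrite eq_le key /=.
have [->|a0] := eqVneq a 0; first by rewrite modulus0 mul0r dual_rnorm_ge0.
have ma : 0 < modulus a.
  by rewrite lt_def modulus_ge0 andbT; apply: contra_neq a0 => /modulus_eq0.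
have := key a^-1 (a *: f); rewrite scalerA mulVf // scale1r modulusV.
by rewrite mulrC ler_pdivlMr // mulrC.
Qed.

Lemma reflexive_represents (Phi : dual X -> K) : reflexive_space X ->
  functional Phi -> (forall f, modulus (Phi f) <= dual_rnorm f) ->
  exists x, Phi = (fun f : dual X => f x).
Proof.
move=> rX lPhi Phile.
pose Psi : {linear dual X -> K^o} :=
  HB.pack (Phi : dual X -> K^o) (GRing.isLinear.Build K (dual X) K^o _ Phi lPhi).
have [|x hx] := rX Psi; last by exists x; apply/funext => f; exact: hx f.
exists 1 => // f c [c0 fc]; rewrite mul1r /= -modulusE -(real_partK c0) of_real_le.
apply: (le_trans (Phile f)); apply: dual_rnorm_le.
  by rewrite -(of_real_le s) of_real0 real_partK.
move=> x; rewrite -(of_real_le s) modulusE of_realM rnormE real_partK //.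
Qed.

End RealNorm.

Lemma rnorm_complete (R : realType) (s : scalars)
    (X : completeNormedModType (scalar_field R s)) (u : nat -> X) :
  (forall e, 0 < e -> exists N, forall m n, (N <= m)%N -> (N <= n)%N ->
    rnorm (u m - u n) < e) ->
  exists l, forall e, 0 < e -> exists N, forall n, (N <= n)%N ->
    rnorm (u n - l) < e.
Proof.
move=> hu; have cu : cvg (u @ \oo).
  apply: cauchy_cvg; apply: cauchy_exP => e e0.
  have re0 : 0 < real_part e by rewrite -(of_real_lt s) of_real0 real_partK ?ltW.
  have [N hN] := hu _ re0; exists (u N); exists N => // n /= Nn.
  rewrite -ball_normE /= -rnormE -(real_partK (ltW e0)) of_real_lt.
  exact: hN.
exists (lim (u @ \oo)) => e e0.
have /cu[N _ hN] : nbhs (lim (u @ \oo)) [set y | rnorm (lim (u @ \oo) - y) < e].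
  by apply/nbhs_rnormP; exists e.
exists N => n Nn; rewrite (seminorm_distC _ _ (rnorm_seminorm X)).
exact: hN.
Qed.

(** The well-ordering gives each nonempty set a unique least element. Sets of two or three points
    yield totality, antisymmetry and transitivity; the least counterexample yields induction. *)
Lemma well_founded_order_exists (T : eqType) : exists prec : T -> T -> Prop,
  [/\ forall P : T -> Prop,
      (forall d, (forall y, prec y d -> P y) -> P d) -> forall d, P d,
    forall x y z, prec x y -> prec y z -> prec x z &
    forall x y, [\/ prec x y, x = y | prec y x]].
Proof.
have [r rwo] := well_ordering_principle T.
have min (A : pred T) x : x \in A -> exists2 z, z \in A &
    forall y, y \in A -> r z y.
  move=> xA; have [|z [[zA zmin] _]] := rwo A; first by exists x.
  by exists z.
have tot x y : r x y \/ r y x.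
  have [|z] := min [pred z | (z == x) || (z == y)] x; first by rewrite !inE eqxx.
  rewrite !inE => /orP[]/eqP-> h.
    by left; apply: h; rewrite !inE eqxx orbT.
  by right; apply: h; rewrite !inE eqxx.
have anti x y : r x y -> r y x -> x = y.
  move=> xy yx; have refl z : r z z by case: (tot z z).
  have [|z [_ zu]] := rwo [pred z | (z == x) || (z == y)].
    by exists x; rewrite !inE eqxx.
  rewrite -(zu x) ?(zu y) //.
    by split=> [|w]; rewrite !inE ?eqxx ?orbT // => /orP[]/eqP->.
  by split=> [|w]; rewrite !inE ?eqxx ?orbT // => /orP[]/eqP->.
have trans x y z : r x y -> r y z -> r x z.
  move=> xy yz; have [|w] := min [pred w | [|| w == x, w == y | w == z]] x.
    by rewrite !inE eqxx.
  rewrite !inE => /or3P[]/eqP-> h.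
  - by apply: h; rewrite !inE eqxx !orbT.
  - have yx : r y x by apply: h; rewrite !inE eqxx.
    by rewrite (anti x y xy yx).
  - have zy : r z y by apply: h; rewrite !inE eqxx !orbT.
    by rewrite -(anti y z yz zy).
exists (fun x y => r x y /\ x <> y); split.
- move=> P IH d; apply: contrapT => nPd.
  have [|z] := min [pred z | `[< ~ P z >]] d; first by apply/asboolP.
  move=> /asboolP nPz zmin; apply: nPz; apply: IH => y [yz neq].
  apply: contrapT => nPy; apply: neq; apply: anti => //; apply: zmin.
  exact/asboolP.
- move=> x y z [xy nxy] [yz nyz]; split; first exact: trans yz.
  by move=> xz; apply: nxy; apply: anti => //; rewrite xz.
- move=> x y; have [->|nxy] := eqVneq x y; first by constructor 2.
  have [xy|yx] := tot x y; first by constructor 1; split=> //; exact/eqP.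
  by constructor 3; split=> //; apply/eqP; rewrite eq_sym.
Qed.

(** * Every closed subspace has a quasicomplement *)

Section Quasicomplementation.
Variables (R : realType) (s : scalars).
Local Notation K := (scalar_field R s).

Lemma countable_range (T : pointedType) (D : set T) : countable D ->
  exists w : nat -> T, D `<=` range w.
Proof.
move=> /countable_injP[f finj].
exists (fun n => xget point [set x | D x /\ f x = n]) => x Dx.
exists (f x) => //; have [] := @xgetPex _ point [set y | D y /\ f y = f x].
  by exists x.
by move=> Dy fy; apply: finj => //; rewrite inE.
Qed.

Lemma quasicomplement_exists (X : completeNormedModType K) (Y : set X) :
  separable X \/ reflexive_space X ->
  linear_subspace Y -> nclosure (@rnorm R s X) Y `<=` Y ->
  quasicomplemented_in (@rnorm R s X) Y setT.
Proof.
move=> hX sY cY; have snu := rnorm_seminorm X.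
have nu0 := @rnorm_eq0 R s X.
case: hX => [[D cD dD]|rX].
  have [w Dw] := countable_range cD.
  apply: (separable_quasicomplement snu nu0 sY cY (w := w)) => //.
  move=> x _; have /dense_nclosure/(_ x) := dD; exact: nclosureS.
have ev_functional (f : dual X) : functional (f : X -> K).
  by have [] := dual_bounded f.
have ev_functionall x : functional (fun f : dual X => f x : K) by [].
have [norming normingP] : exists norming : X -> dual X, forall x,
    (norming x x : K) = of_real s (rnorm x) /\
    forall y, modulus (norming x y : K) <= rnorm y.
  have h x : exists f : dual X, (f x : K) = of_real s (rnorm x) /\
      forall y, modulus (f y : K) <= rnorm y.
    have [f [lf fle fx]] := hahn_banach x snu.
    have [|g gf] := @dual_of_bounded R s X f.
      by split=> //; exists 1 => y; rewrite mul1r.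
    by exists g; rewrite gf.
  by have [f hf] := choice h; exists f.
have [q qd] := scalars_separable R s.
have [prec [prec_ind prec_trans prec_total]] := well_founded_order_exists X.
pose ev (f : dual X) (x : X) : K := f x.
have [adj adjE] := adjoint_exists (D := dual X) (ev := ev) (dual_rnorm_seminorm X)
  ev_functional (@dual_bound R s X)
  (@dual_of_bounded R s X).
have nv (W : set X) (sW : linear_subspace W) := choice (fun f =>
  almost_norming_vector (D := dual X) (ev := ev) snu nu0 (dual_rnorm_seminorm X) ev_functional
    (@dual_bound R s X) f sW).
have [normT hT] := nv setT ltac:(by []); have [normY hY] := nv Y sY.
apply: (reflexive_quasicomplement (D := dual X) (ev := ev) snu nu0 (@rnorm_complete R s X)
  (dual_rnorm_seminorm X) ev_functional ev_functionall (@dual_bound R s X)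
  (@dual_of_bounded R s X) _ qd (norming := norming) _ _ sY cY adjE
  (normT := normT) (normY := normY) _ hY prec_ind prec_trans prec_total).
- by move=> Phi lPhi Phile; exact: reflexive_represents.
- by move=> x; have [] := normingP x.
- by move=> x; have [] := normingP x.
- by move=> f; have [_ h1 h2] := hT f; split=> // x; exact: h2.
Qed.

End Quasicomplementation.

(** * Subspaces and quotients *)

Section Subspaces.
Variables (R : realType) (s : scalars).
Local Notation K := (scalar_field R s).

Lemma submodClosed_subspace (V : lmodType K) (Y : submodClosed V) :
  linear_subspace [set` Y].
Proof. by split=> [|a x y /= hx hy]; rewrite /= ?rpred0 // rpredD ?rpredZ. Qed.

Lemma subspace_submodClosed (V : lmodType K) (S : set V) : linear_subspace S ->
  exists Y : submodClosed V, [set` Y] = S.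
Proof.
move=> [S0 SD]; pose P : {pred V} := fun x => `[< S x >].
have Psub : submod_closed P.
  split; first exact/asboolP.
  by move=> a x y /asboolP hx /asboolP hy; apply/asboolP; exact: SD.
pose Y : submodClosed V :=
  HB.pack P (GRing.isSubmodClosed.Build K V P Psub).
by exists Y; apply/seteqP; split=> x /asboolP.
Qed.

Lemma infinite_codimensional_not_span (V : lmodType K) (Y : submodClosed V)
    (t : seq V) : infinite_codimensional Y ->
  ~ forall x, exists2 y, y \in Y & linear_span [set` t] (x - y).
Proof.
move=> /infinite_dimensional_not_span h xY.
apply: (h (map (quotient_proj Y) t)) => u _.
have [x ->] := quotient_projP u; have [y Yy xy] := xY x.
have -> : quotient_proj Y x = quotient_proj Y (x - y).
  by apply/eqP; rewrite quotient_proj_eq opprB addrC subrK.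
move: (x - y) xy; apply: (@linear_span_min _ _ _ [set` t]
  [set z | linear_span [set` map (quotient_proj Y) t] (quotient_proj Y z)]).
  have sL := linear_span_subspace [set` map (quotient_proj Y) t].
  split; first by rewrite /= raddf0; exact: sL.1.
  by move=> a z z' /= hz hz'; rewrite linearP; exact: sL.2.
by move=> z zt; apply: sub_linear_span; exact: map_f.
Qed.

(** Finitely many classes spanning [Z/F] lift to vectors of [Z], so infinite dimension can be tested
    without the quotient. *)
Lemma infinite_quotient_of_not_span (V : lmodType K) (Z F : submodClosed V) :
  (forall t : seq V, [set` t] `<=` [set` Z] ->
    ~ forall z, z \in Z -> exists2 f, f \in F & linear_span [set` t] (z - f)) ->
  infinite_quotient Z F.
Proof.
move=> h; have sZ := submodClosed_subspace Z.
apply: infinite_dimensional_of_not_span.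
  split; first by exists 0; [exact: sZ.1|rewrite raddf0].
  move=> a _ _ [z Zz <-] [z' Zz' <-]; exists (a *: z + z'); first exact: sZ.2.
  by rewrite linearP.
move=> t tZ.
have hl u : exists z, u \in t -> z \in Z /\ quotient_proj F z = u.
  have [/tZ[z Zz zu]|] := boolP (u \in t); last by exists 0.
  by exists z.
have [g hg] := choice hl; move=> Zt; apply: (h (map g t)).
  by move=> _ /= /mapP[u /hg[gZ _] ->].
move=> z Zz; have : linear_span [set` t] (quotient_proj F z).
  by apply: Zt; exists z.
have : linear_span [set` t] `<=`
    [set u | exists2 w, linear_span [set` map g t] w & quotient_proj F w = u].
  have sL := linear_span_subspace [set` map g t].
  apply: linear_span_min.
    split; first by exists 0; [exact: sL.1|rewrite raddf0].
    move=> a _ _ [w hw <-] [w' hw' <-]; exists (a *: w + w'); first exact: sL.2.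
    by rewrite linearP.
  move=> u ut; exists (g u); first by apply: sub_linear_span; exact: map_f.
  by have [] := hg u ut.
move=> /[apply] -[w hw /eqP]; rewrite quotient_proj_eq => wz.
exists (z - w); last by rewrite opprB addrC subrK.
by rewrite -opprB; exact: (subspaceN (submodClosed_subspace F)).
Qed.

End Subspaces.

(** * Closed subspaces enlarged by finite-dimensional ones *)

Section ClosedSums.
Variables (R : realType) (s : scalars).
Local Notation K := (scalar_field R s).
Variables (V : lmodType K) (nu : V -> R).
Hypothesis snu : seminorm nu.

Definition subspace_add (S T : set V) : set V := [set x + y | x in S & y in T].

Lemma subspace_add_subspace S T : linear_subspace S -> linear_subspace T ->
  linear_subspace (subspace_add S T).
Proof.
move=> [S0 SD] [T0 TD]; split; first by exists 0 => //; exists 0; rewrite ?addr0.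
move=> a _ _ [x Sx [y Ty <-]] [x' Sx' [y' Ty' <-]].
exists (a *: x + x'); first exact: SD.
exists (a *: y + y'); first exact: TD.
by rewrite scalerDr addrACA.
Qed.

Lemma sub_subspace_addl S T : T 0 -> S `<=` subspace_add S T.
Proof. by move=> T0 x Sx; exists x => //; exists 0; rewrite ?addr0. Qed.

Lemma sub_subspace_addr S T : S 0 -> T `<=` subspace_add S T.
Proof. by move=> S0 x Tx; exists 0 => //; exists x; rewrite ?add0r. Qed.

(** If [v] is not in [S], a functional [f] null on [S] and not at [v] reads off the coefficient of
    [v] as [f x / f v], which depends continuously on [x]. *)
Lemma subspace_add_line_closed S v : linear_subspace S ->
  nclosure nu S `<=` S ->
  nclosure nu (subspace_add S (range (fun a => a *: v))) `<=`
    subspace_add S (range (fun a => a *: v)).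
Proof.
move=> sS cS x hx.
have l0 : range (fun a : K => a *: v) 0 by exists 0; rewrite ?scale0r.
have [Sv|Sv] := pselect (S v).
  apply: sub_subspace_addl => //; apply: cS; move: hx; apply: nclosureS.
  by move=> _ [y Sy [_ [a _ <-] <-]]; apply: subspaceD => //; exact: subspaceZ.
have [f [lf fle fS fv]] := hahn_banach_separation snu sS (fun h => Sv (cS _ h)).
pose a := f x / f v; exists (x - a *: v); last first.
  by exists (a *: v); [exists a|rewrite subrK].
apply: cS => e e0.
(* A bound for the norm of the projection [d - (f d / f v) v]. *)
pose C := 1 + nu v / modulus (f v).
have mv : 0 < modulus (f v).
  by rewrite lt_def modulus_ge0 andbT; apply/eqP => /modulus_eq0.
have nv := seminorm_ge0 v snu.
have C0 : 0 < C by rewrite /C ltr_wpDr // divr_ge0 // ltW.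
have [_ [y Sy [_ [b _ <-] <-]] hy] := hx _ (divr_gt0 e0 C0).
exists y => //; pose d := x - (y + b *: v).
have fd : f d = (a - b) * f v.
  rewrite /d (functionalB _ _ lf) (functionalD _ _ lf) (fS y Sy) (functionalZ _ _ lf) add0r.
  by rewrite mulrBl divfK //; exact/eqP.
have -> : x - a *: v - y = d - (a - b) *: v.
  by rewrite /d opprD scalerBl opprB [RHS]addrA [x + (- y - _)]addrA subrK addrAC.
apply: (le_lt_trans (seminormB _ _ snu)); rewrite snu.2.
rewrite ltr_pdivlMr // in hy; apply: le_lt_trans hy.
rewrite /C mulrDr mulr1 lerD // mulrA ler_pdivlMr // mulrAC.
by rewrite ler_wpM2r // -modulusM -fd fle.
Qed.

Lemma subspace_add_span_closed S (t : seq V) : linear_subspace S ->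
  nclosure nu S `<=` S ->
  nclosure nu (subspace_add S (linear_span [set` t])) `<=`
    subspace_add S (linear_span [set` t]).
Proof.
elim: t S => [|v t IH] S sS cS.
  have -> // : subspace_add S (linear_span [set` [::]]) = S.
  apply/seteqP; split=> [_ [x Sx [y hy <-]]|x Sx].
    have s0 : linear_subspace [set 0 : V].
      by split=> // a z z' /= -> ->; rewrite scaler0 addr0.
    have -> : y = 0 by move: y hy; exact: linear_span_min.
    by rewrite addr0.
  by apply: sub_subspace_addl => //; exact: (linear_span_subspace _).1.
have sL (B : set V) := linear_span_subspace B.
have sl : linear_subspace (range (fun a : K => a *: v)).
  split; first by exists 0; rewrite ?scale0r.
  move=> a _ _ [b _ <-] [c _ <-]; exists (a * b + c) => //.
  by rewrite scalerDl scalerA.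
pose S' := subspace_add S (range (fun a : K => a *: v)).
have sS' : linear_subspace S' by exact: subspace_add_subspace.
suff <- : subspace_add S' (linear_span [set` t]) =
    subspace_add S (linear_span [set` v :: t]).
  by apply: IH => //; exact: subspace_add_line_closed.
have tvt : linear_span [set` t] `<=` linear_span [set` v :: t].
  apply: linear_span_min => // w wt; apply: sub_linear_span.
  by rewrite /= inE wt orbT.
apply/seteqP; split.
  move=> _ [_ [x Sx [_ [a _ <-] <-]] [y ty <-]].
  exists x => //; exists (a *: v + y); last by rewrite addrA.
  apply: (sL _).2; last exact: tvt.
  by apply: sub_linear_span; rewrite /= mem_head.
move=> _ [x Sx [y ty <-]].
have [_ [a _ <-] [w tw <-]] : subspace_add (range (fun a : K => a *: v))
    (linear_span [set` t]) y.
  move: y ty; apply: linear_span_min; first exact: subspace_add_subspace.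
  move=> w; rewrite /= inE => /orP[/eqP->|wt].
    apply: sub_subspace_addl; first exact: (sL _).1.
    by exists 1; rewrite ?scale1r.
  by apply: sub_subspace_addr; [exact: sl.1|exact: sub_linear_span].
exists (x + a *: v); first by exists x => //; exists (a *: v) => //; exists a.
by exists w => //; rewrite addrA.
Qed.

End ClosedSums.

(** * Finite alpha *)

Section FiniteDimension.
Variables (R : realType) (s : scalars).
Local Notation K := (scalar_field R s).
Variable X : completeNormedModType K.
Hypothesis hX : separable X \/ reflexive_space X.

Let nu : X -> R := @rnorm R s X.
Let snu : seminorm nu := rnorm_seminorm X.

Lemma closed_nclosure (S : set X) : closed S <-> nclosure nu S `<=` S.
Proof.
rewrite -closure_nclosure; split=> [cS|h]; first by rewrite -(closure_id _).1.
by rewrite closure_id; apply/seteqP; split=> //; exact: subset_closure.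
Qed.

(* A quasicomplement of [Y + F], enlarged by [F], is one of [Y]. *)
Lemma quasicomplement_containing (Y F : submodClosed X) (t : seq X) :
  closed [set` Y] -> infinite_codimensional Y ->
  [set` F] = linear_span [set` t] -> [set` F] `&` [set` Y] = [set 0] ->
  exists Z : submodClosed X,
    [/\ quasicomplement Y Z, [set` F] `<=` [set` Z] & infinite_quotient Z F].
Proof.
move=> /closed_nclosure cY codY Ft FY.
have sY := submodClosed_subspace Y; have sF := submodClosed_subspace F.
pose Y1 := subspace_add [set` Y] [set` F].
have sY1 : linear_subspace Y1 by exact: subspace_add_subspace.
have cY1 : nclosure nu Y1 `<=` Y1.
  by rewrite /Y1 Ft; exact: subspace_add_span_closed.
have [Z1 [sZ1 cZ1 _ Z1Y1 dZ1]] := quasicomplement_exists hX sY1 cY1.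
have [Z ZE] := subspace_submodClosed (subspace_add_subspace sZ1 sF).
have FZ : [set` F] `<=` [set` Z].
  by rewrite ZE; apply: sub_subspace_addr; exact: sZ1.1.
exists Z; split=> //.
  split.
  - apply/closed_nclosure; rewrite ZE Ft; exact: subspace_add_span_closed.
  - rewrite ZE; apply/seteqP; split=> [x [Yx [z Zz [f Ff zfx]]]|_ ->]; last first.
      by split; [exact: sY.1|exact: (subspace_add_subspace sZ1 sF).1].
    (* Being [x - f], the vector [z] is in [Y + F] as well as in [Z1]. *)
    have z0 : z = 0.
      apply: Z1Y1 => //; exists x => //; exists (- f); first exact: subspaceN.
      by rewrite -zfx addrK.
    have -> : x = f by rewrite -zfx z0 add0r.
    suff : [set 0] f by [].
    by rewrite -FY; split=> //; rewrite -[f]add0r -z0 zfx.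
  - apply/dense_nclosure => x; move: (dZ1 x Logic.I); apply: nclosureS.
    move=> _ [_ [[y Yy [f Ff <-]] _] [z Zz <-]].
    exists y => //; exists (z + f); last by rewrite addrAC addrA.
    by rewrite ZE; exists z => //; exists f.
(* If [Z] were [F] plus the span of [t'], then [Y + F] plus that span would be closed and contain
   the dense [Y + F + Z1]; so [t] and [t'] would span [X] modulo [Y]. *)
apply: infinite_quotient_of_not_span => t' _ h.
apply: (@infinite_codimensional_not_span _ _ _ Y (t ++ t')) => // x.
have : subspace_add Y1 (linear_span [set` t']) x.
  apply: (subspace_add_span_closed snu sY1 cY1).
  move: (dZ1 x Logic.I); apply: nclosureS => _ [y1 [Y1y1 _] [z Zz <-]].
  have [|f Ff zf] := h z.
    suff : [set` Z] z by [].
    by rewrite ZE; apply: sub_subspace_addl => //; exact: sF.1.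
  exists (y1 + f).
    apply: subspaceD => //; apply: sub_subspace_addr => //; exact: sY.1.
  by exists (z - f) => //; rewrite addrACA subrr addr0.
move=> [_ [y Yy [f Ff <-]] [w tw <-]]; exists y => //.
have -> : y + f + w - y = f + w by rewrite addrC !addrA addNr add0r.
have sub (r : seq X) : {subset r <= t ++ t'} ->
    linear_span [set` r] `<=` linear_span [set` t ++ t'].
  move=> rt; apply: linear_span_min; first exact: linear_span_subspace.
  by move=> v /rt vt; exact: sub_linear_span.
apply: subspaceD; first exact: linear_span_subspace.
  by apply: (sub t) => [v vt|]; rewrite ?mem_cat ?vt // -Ft.
by apply: (sub t') => // v vt; rewrite mem_cat vt orbT.
Qed.

Lemma quasicomplemented_closed (Y : submodClosed X) : closed [set` Y] ->
  quasicomplemented Y.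
Proof.
move=> /closed_nclosure cY; have sY := submodClosed_subspace Y.
have [Z [sZ cZ _ ZY dZ]] := quasicomplement_exists hX sY cY.
have [Z' Z'E] := subspace_submodClosed sZ; exists Z'; rewrite /quasicomplement Z'E.
split; first exact/closed_nclosure.
  apply/seteqP; split=> [x [Yx Zx]|_ ->]; first exact: ZY.
  by split; [exact: sY.1|exact: sZ.1].
apply/dense_nclosure => x; move: (dZ x Logic.I); apply: nclosureS.
by move=> _ [y [Yy _] [z Zz <-]]; exists y => //; exists z.
Qed.

End FiniteDimension.

(** * Infinite alpha *)

Section Converse.
Variables (R : realType) (s : scalars).
Local Notation K := (scalar_field R s).

(* Shifting the basis vectors [b n] and adding multiples of [b 0]: the span of
   the perturbed basis misses [b 0], which is nevertheless in its closure when
   [c n *: b n.+1] tends to [0]. *)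
Section Perturbation.
Variables (V : lmodType K) (B : set V) (b : nat -> V) (c : nat -> K).
Hypothesis iB : linearly_independent B.
Hypothesis b_inj : injective b.
Hypothesis Bb : forall n, B (b n).
Hypothesis c0 : forall n, c n != 0.

Definition perturb (v : V) : V :=
  if pselect (exists n, v = b n) is left h
  then b 0 + c (projT1 (cid h)) *: b (projT1 (cid h)).+1 else v.

Lemma perturb_b n : perturb (b n) = b 0 + c n *: b n.+1.
Proof.
rewrite /perturb; case: pselect => [h|[]]; last by exists n.
by have /b_inj <- := projT2 (cid h).
Qed.

(** A uniform formula for the two cases: on [b n] the shift goes to [b n.+1] with [k = 1] and
    [l = c n]; elsewhere the shift is the identity with [k = 0] and [l = 1]. *)
Lemma perturbE : exists (shift : V -> V) (k l : V -> K), forall v,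
  [/\ perturb v = k v *: b 0 + l v *: shift v, l v != 0, B v -> B (shift v),
    shift v != b 0 & forall w, shift v = shift w -> v = w].
Proof.
pose P v := exists n, v = b n.
pose sh v := if pselect (P v) is left h then b (projT1 (cid h)).+1 else v.
have sh_b n : sh (b n) = b n.+1.
  rewrite /sh; case: pselect => [h|[]]; last by exists n.
  by have /b_inj <- := projT2 (cid h).
have sh_n v : ~ P v -> sh v = v by rewrite /sh; case: pselect.
pose k v : K := if pselect (P v) then 1 else 0.
pose l v := if pselect (P v) is left h then c (projT1 (cid h)) else 1.
have sh_inj v w : sh v = sh w -> v = w.
  have [[n ->]|nv] := pselect (P v); have [[m ->]|nw] := pselect (P w).
  - by rewrite !sh_b => /b_inj[->].
  - by rewrite sh_b (sh_n w) // => e; case: nw; exists n.+1.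
  - by rewrite sh_b (sh_n v) // => e; case: nv; exists m.+1.
  - by rewrite !sh_n.
exists sh, k, l => v; split; last exact: sh_inj.
- rewrite /perturb /k /l /sh /P; case: pselect => h.
    by rewrite scale1r.
  by rewrite scale0r add0r scale1r.
- by rewrite /l; case: pselect => [h|_]; rewrite ?oner_neq0.
- have [[n ->]|nv] := pselect (P v); first by rewrite sh_b.
  by rewrite sh_n.
- apply/eqP; have [[n ->]|nv] := pselect (P v); first by rewrite sh_b => /b_inj.
  by rewrite sh_n // => e; apply: nv; exists 0%N.
Qed.

(** The relation becomes one between [b 0] and the distinct vectors [shift v], where [shift v] has
    coefficient [a v * l v]. Taking [d = 0] gives independence, any [d] that the new span misses the
    line of [b 0]. *)
Lemma perturb_independent t (a : V -> K) d : uniq t -> [set` t] `<=` B ->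
  \sum_(v <- t) a v *: perturb v = d *: b 0 -> forall v, v \in t -> a v = 0.
Proof.
have [sh [k [l hE]]] := perturbE.
move=> ut tB e v vt.
(* Coefficients must be a function of the vector; by injectivity of the shift, the sum for [w] has
   at most one term. *)
pose g w := if w == b 0 then \sum_(v <- t) a v * k v - d
  else \sum_(v <- t | sh v == w) a v * l v.
have shI : injective sh by move=> x y; have [_ _ _ _] := hE x; exact.
have gsh x : x \in t -> g (sh x) = a x * l x.
  move=> xt; have [_ _ _ /negbTE sx _] := hE x; rewrite /g sx.
  rewrite (big_rem x) //= eqxx big_seq_cond big1 ?addr0 // => y.
  by rewrite mem_rem_uniq // inE => /andP[/andP[/negbTE yx _]]; rewrite inj_eq // yx.
have gb0 : g (b 0) = \sum_(v <- t) a v * k v - d by rewrite /g eqxx.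
have : \sum_(w <- b 0 :: map sh t) g w *: w = 0.
  rewrite big_cons big_map gb0.
  have -> : \sum_(x <- t) g (sh x) *: sh x = \sum_(x <- t) (a x * l x) *: sh x.
    by rewrite big_seq [RHS]big_seq; apply: eq_bigr => x xt; rewrite gsh.
  rewrite scalerBl -e scaler_suml addrAC -big_split /= -sumrB big1 //.
  move=> x _; have [-> _ _ _ _] := hE x.
  by rewrite scalerDr !scalerA subrr.
move=> e0; have : a v * l v = 0.
  rewrite -gsh //; apply: (iB (s := b 0 :: map sh t)) => //.
  - rewrite /= map_inj_uniq // ut andbT; apply/mapP => -[x _ /eqP].
    by have [_ _ _ /negbTE] := hE x; rewrite eq_sym => ->.
  - move=> w; rewrite /= inE => /orP[/eqP->//|/mapP[x /tB Bx ->]].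
    by have [_ _ + _ _] := hE x; apply.
  - by rewrite inE map_f ?orbT.
by move=> /eqP; rewrite mulf_eq0; have [_ /negbTE-> _ _ _] := hE v;
  rewrite orbF => /eqP.
Qed.

Lemma perturb_inj : {in B &, injective perturb}.
Proof.
move=> v w; rewrite !inE => Bv Bw e; apply: contrapT => /eqP vw.
have := @perturb_independent [:: v; w] (fun x => if x == v then 1 else -1) 0.
rewrite /= !inE vw !big_cons big_nil eqxx eq_sym (negbTE vw) e scale1r scaleN1r.
rewrite addr0 subrr scale0r => /(_ isT) h.
have := h _ erefl v; rewrite inE eqxx => /(_ _ isT).
move=> hh; have /eqP := hh ltac:(by move=> x; rewrite /= !inE => /orP[]/eqP->).
by rewrite oner_eq0.
Qed.

Lemma perturb_sum t (a : V -> K) : uniq t -> [set` t] `<=` perturb @` B ->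
  exists r : V -> V, [/\ {in t, cancel r perturb}, uniq (map r t),
    [set` map r t] `<=` B &
    \sum_(w <- t) a w *: w = \sum_(v <- map r t) a (perturb v) *: perturb v].
Proof.
move=> ut tB.
have hr w : exists v, w \in t -> B v /\ perturb v = w.
  have [/tB[v Bv vw]|] := boolP (w \in t); last by exists 0.
  by exists v.
have [r r_t] := choice hr.
have rK : {in t, cancel r perturb} by move=> w /r_t[].
exists r; split=> //.
- by rewrite map_inj_in_uniq //; exact: can_in_inj rK.
- by move=> _ /= /mapP[w /r_t[Bw _] ->].
- rewrite big_map big_seq [RHS]big_seq; apply: eq_bigr => w wt.
  by rewrite !rK.
Qed.

Lemma perturb_basis_independent : linearly_independent (perturb @` B).
Proof.
move=> t a ut tB; have [r [rK ur rB ->]] := perturb_sum a ut tB => e w wt.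
have := @perturb_independent (map r t) (a \o perturb) 0 ur rB.
rewrite scale0r => /(_ e (r w)) /=; rewrite rK // => -> //.
exact: map_f.
Qed.

Lemma perturb_span_b0 d : linear_span (perturb @` B) (d *: b 0) -> d *: b 0 = 0.
Proof.
move=> /linear_span_uniq[t [a [ut tB e]]].
have [r [rK ur rB e']] := perturb_sum a ut tB.
rewrite e e' big_seq big1 // => v vt.
have := @perturb_independent (map r t) (a \o perturb) d ur rB.
by rewrite -e' e => /(_ erefl v vt) /= ->; rewrite scale0r.
Qed.

End Perturbation.

Variable X : completeNormedModType K.

(** [F0] supplies a basis of cardinality [A]. Only a countable part [b] of it is perturbed, and
    injectively, so the cardinality is kept; [Y] is the line through [b 0]. *)
Lemma not_totally_quasicomplemented (A : Type) (F0 : submodClosed X) :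
  has_dimension [set` F0] A -> [set: nat] #<= [set: A] ->
  exists Y : submodClosed X, [/\ closed [set` Y], infinite_codimensional Y &
    ~ totally_quasicomplemented A Y].
Proof.
move=> [B hB BA] natA; have [iB BF0] := hB.
have : [set: nat] #<= B by rewrite (card_le_eqr BA).
move=> natB; have /pcard_leP[f] := natB.
pose b (n : nat) : X := f n.
have b_inj : injective b.
  by move=> m n; apply: (@inj _ _ _ f); rewrite inE.
have Bb n : B (b n).
  exact: (@funS _ _ _ _ f).
have infB : infinite_set B by exact/infiniteP.
have bn0 n : b n != 0.
  apply/eqP => e; have := iB [:: b n] (fun=> 1) erefl.
  rewrite big_seq1 e scaler0 => h; have /eqP : 1 = 0 :> K.
    by apply: (h _ erefl 0); [move=> x; rewrite /= inE -e => /eqP->|exact: mem_head].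
  by rewrite oner_eq0.
have snu := rnorm_seminorm X; have nu0 := @rnorm_eq0 R s X.
have nb n : 0 < rnorm (b n).
  rewrite lt_def (seminorm_ge0 _ snu) andbT; apply: contra_neq (bn0 n) => h.
  exact: nu0.
(* Gives [c n *: b n.+1] the norm [1 / (n + 1)]. *)
pose c n := of_real s (n.+1%:R * rnorm (b n.+1))^-1.
have cp n : 0 < (n.+1%:R * rnorm (b n.+1))^-1 by rewrite invr_gt0 mulr_gt0.
have c0 n : c n != 0.
  by rewrite /c -(of_real0 R s) (inj_eq (@of_real_inj R s)) gt_eqF.
pose B' := perturb b c @` B.
have iB' : linearly_independent B' by exact: perturb_basis_independent.
have [F FE] := subspace_submodClosed (linear_span_subspace B').
have dimF : has_dimension [set` F] A.
  exists B'; first by rewrite FE.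
  apply: card_eq_trans BA; apply: inj_card_eq; exact: perturb_inj.
have [Y YE] := subspace_submodClosed (linear_span_subspace [set` [:: b 0]]).
have Yb a : [set` Y] (a *: b 0).
  rewrite YE; apply: subspaceZ; first exact: linear_span_subspace.
  by apply: sub_linear_span; rewrite /= mem_head.
have Yline y : [set` Y] y -> exists a, y = a *: b 0.
  rewrite YE => -[t [a [tb ->]]]; exists (\sum_(v <- t) a v).
  rewrite scaler_suml big_seq [RHS]big_seq; apply: eq_bigr => v /tb.
  by rewrite /= inE => /eqP->.
exists Y; split.
- apply/closed_nclosure.
  have s0 : linear_subspace [set 0 : X].
    by split=> // a z z' /= -> ->; rewrite scaler0 addr0.
  have c00 : nclosure (@rnorm R s X) [set 0] `<=` [set 0].
    move=> x hx /=; apply: nu0; apply/eqP.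
    rewrite eq_le (seminorm_ge0 _ snu) andbT; apply/ler_addgt0Pl => e e0.
    by rewrite addr0; have [_ /= -> ] := hx _ e0; rewrite subr0 => /ltW.
  have -> : [set` Y] = subspace_add [set 0] [set` Y].
    apply/seteqP; split=> [x Yx|_ [_ /= -> [x Yx <-]]]; last by rewrite add0r.
    exact: sub_subspace_addr.
  by rewrite YE; exact: subspace_add_span_closed.
(* Lifts of finitely many classes spanning the quotient would, together with [b 0], span the
   infinite-dimensional [F0]. *)
- apply: infinite_dimensional_of_not_span; first by split.
  move=> t _ ht.
  have infF0 : infinite_dimensional [set` F0] by exists B.
  have hl u : exists x, quotient_proj Y x = u.
    by have [x ->] := quotient_projP u; exists x.
  have [g gK] := choice hl.
  apply: (infinite_dimensional_not_span (t := b 0 :: map g t) infF0) => x _.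
  have sL := linear_span_subspace [set` b 0 :: map g t].
  have : linear_span [set` t] `<=` [set u | exists2 w,
      linear_span [set` b 0 :: map g t] w & quotient_proj Y w = u].
    apply: linear_span_min.
      split; first by exists 0; [exact: sL.1|rewrite raddf0].
      move=> a _ _ [w hw <-] [w' hw' <-].
      exists (a *: w + w'); first exact: sL.2.
      by rewrite linearP.
    move=> u ut; exists (g u) => //; apply: sub_linear_span.
    by rewrite /= inE map_f ?orbT.
  move=> /(_ (quotient_proj Y x)) [|w hw /eqP]; first exact: ht.
  rewrite quotient_proj_eq => /Yline[a wx].
  have -> : x = w - a *: b 0 by rewrite -wx opprB addrC subrK.
  apply: subspaceB => //; apply: subspaceZ => //.
  by apply: sub_linear_span; rewrite /= mem_head.
- move=> [_ /(_ F dimF)] [|Z [[cZ YZ _] FZ _]].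
    apply/seteqP; split=> [x [Fx /Yline[a xa]]|_ ->]; last first.
      by split; exact: (submodClosed_subspace _).1.
    rewrite xa /=; apply: (perturb_span_b0 iB b_inj Bb c0).
    by rewrite -xa -/B' -FE.
  suff Zb : [set` Z] (b 0).
    have : ([set` Y] `&` [set` Z]) (b 0) by split=> //; rewrite -[b 0]scale1r.
    by rewrite YZ => /eqP; exact/negP.
  apply: (closed_nclosure _).1 cZ _ _ => e e0.
  pose n := Num.truncn e^-1.
  exists (perturb b c (b n)).
    apply: FZ; rewrite FE; apply: sub_linear_span; exists (b n) => //.
  rewrite perturb_b // opprD addrA subrr add0r (seminormN _ snu) snu.2.
  rewrite modulus_of_real gtr0_norm // invfM mulrAC -mulrA divff ?gt_eqF //.
  rewrite mulr1 invf_plt ?posrE //.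
  exact: truncnS_gt.
Qed.

End Converse.

(** For an infinite cardinal that is the dimension of no subspace of [X], the condition on [F] would
    hold vacuously; [hA] ensures that an infinite [A] is tested by at least one subspace. *)
Theorem theorem2p5 (A : Type) (R : realType) (s : scalars)
    (X : completeNormedModType (scalar_field R s))
    (hX : separable X \/ reflexive_space X)
    (hA : [set: nat] #<= [set: A] ->
          exists F : submodClosed X, has_dimension [set` F] A) :
  (forall Y : submodClosed X,
      closed [set` Y] -> infinite_codimensional Y ->
      totally_quasicomplemented A Y)
  <-> ([set: A] #<= [set: nat]) && ~~ ([set: nat] #<= [set: A]).
Proof.
split=> [h|/andP[_ finA] Y cY codY].
  have nA : ~ ([set: nat] #<= [set: A]).
    move=> natA; have [F0 dimF0] := hA natA.
    have [Y [cY codY]] := not_totally_quasicomplemented dimF0 natA.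
    by apply; exact: h.
  apply/andP; split; last exact/negP.
  apply: finite_set_countable; apply: contrapT => /infiniteP; exact: nA.
split; first exact: quasicomplemented_closed.
move=> F [B [_ BF] BA] FY.
have /finite_seqP[t tB] : finite_set B.
  by apply: contrapT => /infiniteP; rewrite (card_le_eqr BA); exact/negP.
by apply: (quasicomplement_containing hX (t := t)) => //; rewrite -tB BF.
Qed.
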